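(* For any $\alpha\in(0,1]$, the first return map of the geodesic flow on $T^1\mathcal M$ to $\widetilde\Sigma_\alpha$ is given by $$\Phi_\alpha:\widetilde\Sigma_\alpha\to\widetilde\Sigma_\alpha,\qquad (x,y,\sigma)\mapsto\bigl(\,T_\alpha(x),\ \varepsilon(x)\,x(1-xy),\ -\varepsilon(x)\,\sigma\,\bigr).$$
   Context: **$\alpha$-continued fractions.** For $\alpha\in(0,1]$ let $\mathbb I_\alpha=[\alpha-1,\alpha]$ and define $T_\alpha:\mathbb I_\alpha\to\mathbb I_\alpha$ by $T_\alpha(x)=\left|\frac1x\right|-\left\lfloor\left|\frac1x\right|+1-\alpha\right\rfloor$ for $x\ne0$, $T_\alpha(0)=0$. Put $\varepsilon(x)=1$ if $x\ge0$, $\varepsilon(x)=-1$ if $x<0$, and $d_\alpha(x)=\left\lfloor\left|\frac1x\right|+1-\alpha\right\rfloor$ (with $d_\alpha(0)=\infty$). Define $\mathcal T_\alpha(x,y)=\left(T_\alpha(x),\frac{1}{d_\alpha(x)+\varepsilon(x)y}\right)$ for $x\in\mathbb I_\alpha$, $y\in[0,1]$, and let $\Omega_\alpha$ be the closure of the union of the $\mathcal T_\alpha$-orbits of the points $(x,0)$, $x\in\mathbb I_\alpha$. **Geodesic flow.** $\mathcal M=\mathrm{SL}_2(\mathbb Z)\backslash\mathbb H$ is the modular surface, with unit tangent bundle $T^1\mathcal M=\mathrm{PSL}_2(\mathbb Z)\backslash\mathrm{PSL}_2(\mathbb R)$. The geodesic flow sends the class of $A$ to the class of $Ag_t$, $g_t=\begin{pmatrix}e^{t/2}&0\\0&e^{-t/2}\end{pmatrix}$.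 The first return map to a set $\mathcal C\subset T^1\mathcal M$ is $v\mapsto g_{\tau(v)}(v)$, with $\tau(v)>0$ minimal such that the image is in $\mathcal C$ (defined a.e.). **The set $\widetilde\Sigma_\alpha$.** Let $\mathcal Z(x,y)=(x,\,y/(1+xy))$ for $xy\neq-1$, and $\Sigma_\alpha=\mathcal Z(\Omega_\alpha)\subset\mathbb R^2$. For $(x,y)\in\mathbb R^2$ let $$A_{-1}(x,y)=\begin{pmatrix}1&y\\-x&1-xy\end{pmatrix},\qquad A_{+1}(x,y)=\begin{pmatrix}x&1-xy\\-1&y\end{pmatrix}.$$ For $\sigma\in\{-1,+1\}$ let $\widetilde\Sigma_{\alpha,\sigma}$ be the set of classes in $\mathrm{PSL}_2(\mathbb Z)\backslash\mathrm{PSL}_2(\mathbb R)$ represented by $A_\sigma(x,y)$ with $(x,y)\in\Sigma_\alpha$, and let $\widetilde\Sigma_\alpha=\widetilde\Sigma_{\alpha,-1}\cup\widetilde\Sigma_{\alpha,+1}$. The class of $A_\sigma(x,y)$ is denoted $(x,y,\sigma)$; this labelling is unambiguous for almost every point. The set $\widetilde\Sigma_\alpha$ carries the measure $\ell$ induced by Lebesgue measure $dx\,dy$ on $\Sigma_\alpha$ (on each of the two sheets $\sigma=\pm1$). Statements about maps on $\widetilde\Sigma_\alpha$ are understood $\ell$-almost everywhere. *)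

(* Defs.v *)
From HB Require Import structures.
From mathcomp Require Import all_boot all_order all_algebra generic_quotient.
From mathcomp Require Import all_classical all_reals all_analysis.
From mathcomp Require Import measurable_realfun.
From mathcomp Require Import ring lra.

Set Implicit Arguments.
Unset Strict Implicit.
Unset Printing Implicit Defensive.

Import Order.TTheory GRing.Theory Num.Theory.
Import numFieldNormedType.Exports.

Local Open Scope classical_set_scope.
Local Open Scope ring_scope.
Local Open Scope quotient_scope.

Section AlphaContinuedFractions.
Context {R : realType}.
Implicit Types (alpha x y : R) (p : R * R).

Definition eps x : R := if 0 <= x then 1 else -1.

(* For x != 0; the value d_alpha(0) = oo is dealt with where it is used. *)
Definition digit alpha x : R := (Num.floor (`|x^-1| + 1 - alpha))%:~R.

Definition Tmap alpha x : R :=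
  if x == 0 then 0 else `|x^-1| - digit alpha x.

(* For x = 0, the second coordinate is 1/(oo + y) = 0. *)
Definition natext alpha p : R * R :=
  if p.1 == 0 then (0, 0)
  else (Tmap alpha p.1, (digit alpha p.1 + eps p.1 * p.2)^-1).

Definition Omega alpha : set (R * R) :=
  closure [set p | exists (n : nat) x,
    alpha - 1 <= x <= alpha /\ p = iter n (natext alpha) (x, 0)].

Definition Zmap p : R * R := (p.1, p.2 / (1 + p.1 * p.2)).

Definition Sigma alpha : set (R * R) :=
  Zmap @` (Omega alpha `&` [set p | p.1 * p.2 != -1]).

End AlphaContinuedFractions.

Section UnitTangentBundle.
Context {R : realType}.

Definition mx2 (a b c d : R) : 'M[R]_2 :=
  \matrix_(i, j) (if i == 0 then if j == 0 then a else b
                  else if j == 0 then c else d).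

Lemma det_mx2 a b c d : \det (mx2 a b c d) = a * d - b * c.
Proof.
rewrite (expand_det_row _ 0) !big_ord_recl big_ord0 /cofactor !det_mx11 !mxE /=.
by rewrite /bump /= expr0 expr1 !mul1r mulN1r addr0 mulrN.
Qed.

End UnitTangentBundle.

Definition SL2 (R : realType) := {A : 'M[R]_2 | \det A == 1}.
HB.instance Definition _ (R : realType) := Choice.on (SL2 R).

Section ModularSurface.
Context {R : realType}.
Implicit Types (A B C : SL2 R).

Lemma det_sl2 A : \det (val A) = 1. Proof. exact/eqP/(valP A). Qed.

Lemma sl2_one_subproof : \det (1%:M : 'M[R]_2) == 1.
Proof. by rewrite det1. Qed.
Definition sl2_one : SL2 R := exist _ 1%:M sl2_one_subproof.

Lemma sl2_mul_subproof A B : \det (val A *m val B) == 1.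
Proof. by rewrite det_mulmx !det_sl2 mulr1. Qed.
Definition sl2_mul A B : SL2 R := exist _ (val A *m val B) (sl2_mul_subproof A B).

(* As -1 lies in SL_2(Z), this relation also identifies A and -A: its classes *)
(* are the points of SL_2(Z)\SL_2(R) = PSL_2(Z)\PSL_2(R).                     *)
Definition sl2z_rel A B : bool :=
  `[< exists M : 'M[int]_2, \det M = 1 /\ val B = map_mx intr M *m val A >].

Lemma sl2z_refl : reflexive sl2z_rel.
Proof.
by move=> A; apply/asboolP; exists 1%:M; rewrite det1 map_mx1 mul1mx.
Qed.

Lemma sl2z_sym : symmetric sl2z_rel.
Proof.
suff h A B : sl2z_rel A B -> sl2z_rel B A by move=> A B; apply/idP/idP; exact: h.
move=> /asboolP[M [dM BE]]; apply/asboolP; exists (\adj M).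
have e : \adj M *m M = 1%:M by rewrite mul_adj_mx dM.
split.
  by have := congr1 determinant e; rewrite det_mulmx dM mulr1 det1.
by rewrite BE mulmxA -map_mxM e map_mx1 mul1mx.
Qed.

Lemma sl2z_trans : transitive sl2z_rel.
Proof.
move=> B A C /asboolP[M [dM BE]] /asboolP[N [dN CE]]; apply/asboolP.
by exists (N *m M); rewrite det_mulmx dM dN mulr1 CE BE mulmxA map_mxM.
Qed.

Definition sl2z_equiv : equiv_rel (SL2 R) :=
  EquivRel sl2z_rel sl2z_refl sl2z_sym sl2z_trans.

End ModularSurface.

Definition T1M (R : realType) : Type := {eq_quot (@sl2z_equiv R)}.

Section GeodesicFlow.
Context {R : realType}.
Implicit Types (A B : SL2 R) (v w : T1M R) (t : R).

Definition cls A : T1M R := \pi_({eq_quot (@sl2z_equiv R)}) A.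

Lemma clsP A B : cls A = cls B <->
  exists M : 'M[int]_2, \det M = 1 /\ val B = map_mx intr M *m val A.
Proof.
by split=> [/eqmodP/asboolP//|h]; apply/eqmodP/asboolP.
Qed.

Lemma geod_subproof t : \det (mx2 (expR (t / 2)) 0 0 (expR (- (t / 2)))) == 1.
Proof. by rewrite det_mx2 -expRD subrr expR0 mul0r subr0. Qed.
Definition geod t : SL2 R := exist (fun A : 'M[R]_2 => \det A == 1) _ (geod_subproof t).

Definition flow t v : T1M R :=
  cls (sl2_mul (repr (v : {eq_quot (@sl2z_equiv R)})) (geod t)).

Lemma flow_cls t A : flow t (cls A) = cls (sl2_mul A (geod t)).
Proof.
have /clsP[M [dM AE]] :
    cls (repr (cls A : {eq_quot (@sl2z_equiv R)})) = cls A by exact: reprK.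
by apply/clsP; exists M; split=> //=; rewrite AE mulmxA.
Qed.

(* The graph of the first return map to C; it is a partial map. *)
Definition first_return (C : set (T1M R)) v w : Prop :=
  exists tau : R, [/\ 0 < tau, C (flow tau v),
    (forall t, 0 < t < tau -> ~ C (flow t v)) & w = flow tau v].

End GeodesicFlow.

Section CrossSection.
Context {R : realType}.
Implicit Types (alpha x y s : R).

(* The sign sigma = s is meant to be -1 or 1. *)
Definition Amx s x y : 'M[R]_2 :=
  if s == 1 then mx2 x (1 - x * y) (-1) y else mx2 1 y (- x) (1 - x * y).

Lemma Amx_subproof s x y : \det (Amx s x y) == 1.
Proof. by rewrite /Amx; case: ifP => _; rewrite det_mx2; apply/eqP; ring. Qed.
Definition Asl2 s x y : SL2 R := exist _ (Amx s x y) (Amx_subproof s x y).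

(* The point of the unit tangent bundle with label (x, y, s). *)
Definition pt (q : R * R * R) : T1M R := cls (Asl2 q.2 q.1.1 q.1.2).

Definition Sigmat_sheet alpha s : set (T1M R) :=
  [set pt (p, s) | p in Sigma alpha].

Definition Sigmat alpha : set (T1M R) :=
  Sigmat_sheet alpha (-1) `|` Sigmat_sheet alpha 1.

(* The map Phi_alpha on labels. *)
Definition Phi alpha (q : R * R * R) : R * R * R :=
  let: (x, y, s) := q in
  (Tmap alpha x, eps x * x * (1 - x * y), - eps x * s).

End CrossSection.

(* A set of classes is measurable when the set of all its representatives is *)
(* Borel in the four matrix entries.                                         *)
Section MeasurableStructure.
Context {R : realType}.
Local Notation mR := (measurableTypeR R).

Definition entries (A : SL2 R) : mR * mR * mR * mR :=
  (val A 0 0, val A 0 1, val A 1 0, val A 1 1).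

Definition T1M_measurable : set (set (T1M R)) :=
  image_set_system setT cls (preimage_set_system setT entries measurable).

Lemma T1M_sigma_algebra : sigma_algebra setT T1M_measurable.
Proof.
apply: sigma_algebra_image; apply: sigma_algebra_preimage.
exact: sigma_algebra_measurable.
Qed.

Lemma T1M_measurable0 : T1M_measurable set0.
Proof. by have [] := T1M_sigma_algebra. Qed.

Lemma T1M_measurableC B : T1M_measurable B -> T1M_measurable (~` B).
Proof. by rewrite -setTD; have [_ + _] := T1M_sigma_algebra; apply. Qed.

Lemma T1M_measurable_bigcup (F : (set (T1M R))^nat) :
  (forall i, T1M_measurable (F i)) -> T1M_measurable (\bigcup_i F i).
Proof. by have [_ _] := T1M_sigma_algebra; apply. Qed.

HB.instance Definition _ := Choice.on (T1M R).
HB.instance Definition _ := isPointed.Build (T1M R) (cls sl2_one).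
HB.instance Definition _ := @isMeasurable.Build default_measure_display
  (T1M R) T1M_measurable T1M_measurable0 T1M_measurableC
  T1M_measurable_bigcup.

Lemma measurable_open_prod (U : set (R * R)) :
  open U -> measurable (U : set (mR * mR)).
Proof.
move=> oU.
pose box (i : rat * rat * rat * rat) : set (mR * mR) :=
  `]ratr i.1.1.1, ratr i.1.1.2[ `*` `]ratr i.1.2, ratr i.2[.
pose F i : set (mR * mR) := if `[< box i `<=` U >] then box i else set0.
have -> : U = \bigcup_i F i.
  apply/seteqP; split => [[x y] Uxy|z [i _]]; last first.
    by rewrite /F; case: asboolP => // sub /sub.
  have : nbhs (x, y) U by exact: open_nbhs_nbhs.
  move=> /nbhs_ballP[e /= e0 eU].
  have lB z : z - e < z by rewrite ltrBlDr ltrDl.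
  have lD z : z < z + e by rewrite ltrDl.
  have [a ha] := rat_in_itvoo (lB x); have [b hb] := rat_in_itvoo (lD x).
  have [c hc] := rat_in_itvoo (lB y); have [d hd] := rat_in_itvoo (lD y).
  exists (a, b, c, d) => //; rewrite /F; case: asboolP => [_|].
    move: ha hb hc hd; rewrite !in_itv/= => /andP[_ ?] /andP[? _] /andP[_ ?].
    by move=> /andP[? _]; split; rewrite /= in_itv/=; apply/andP.
  case=> -[x' y'] [/=]; rewrite !in_itv/= => /andP[x1 x2] /andP[y1 y2].
  move: ha hb hc hd; rewrite !in_itv/= => /andP[? ?] /andP[? ?] /andP[? ?].
  move=> /andP[? ?]; apply: eU; split; rewrite /= /ball/= ltr_norml; lra.
apply: countable_bigcupT_measurable => // i.
by rewrite /F; case: asboolP => // _; apply: measurableX.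
Qed.

Lemma measurable_Omega (alpha : R) : measurable (Omega alpha : set (mR * mR)).
Proof.
rewrite -(setCK (Omega alpha)); apply: measurableC.
by apply: measurable_open_prod; apply: closed_openC; exact: closed_closure.
Qed.

Lemma SigmaE (alpha : R) : Sigma alpha =
  [set q | 1 - q.1 * q.2 != 0 /\ Omega alpha (q.1, q.2 / (1 - q.1 * q.2))].
Proof.
apply/seteqP; split => [_ [[x y] [Oxy /= xy] <-]|[x y] /= [xy Oxy]] /=.
  have xy' : 1 + x * y != 0 by apply: contra xy => /eqP h; apply/eqP; lra.
  have e : 1 - x * (y / (1 + x * y)) = (1 + x * y)^-1 by field.
  by rewrite e invrK divfK // invr_eq0.
exists (x, y / (1 - x * y)).
  split => //=; apply/eqP => /(congr1 (fun z => (z + 1) * (1 - x * y))).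
  rewrite addNr mul0r (_ : _ * _ = 1); last by field.
  by move/eqP; rewrite oner_eq0.
rewrite /Zmap/=; congr pair; field; rewrite xy /=.
by rewrite subrK oner_neq0.
Qed.

Lemma measurable_invr : measurable_fun setT (fun x : mR => x^-1 : mR).
Proof.
have e : [set x : mR | x != 0] = ~` [set 0].
  by apply/seteqP; split => x /= /eqP.
rewrite (_ : setT = [set x : mR | x != 0] `|` [set 0]); last first.
  by apply/seteqP; split => // x _; case: (eqVneq x 0) => [->|]; [right|left].
apply/measurable_funU => //; first by rewrite e; apply: measurableC.
split; last exact: measurable_fun_set1.
apply: open_continuous_measurable_fun.
  by rewrite e; apply: closed_openC; exact: closed_eq.
by move=> x; rewrite inE => /= x0; exact: inv_continuous.
Qed.

Lemma measurable_Sigma (alpha : R) : measurable (Sigma alpha : set (mR * mR)).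
Proof.
pose g (q : mR * mR) : mR := 1 - q.1 * q.2.
have mg : measurable_fun setT g.
  by apply: measurable_funB => //; apply: measurable_funM.
rewrite SigmaE.
rewrite (_ : [set _ | _] = g @^-1` (~` [set 0]) `&`
   (fun q : mR * mR => (q.1, q.2 * (g q)^-1) : mR * mR) @^-1` Omega alpha).
  apply: measurableI.
    by rewrite -[X in measurable X]setTI; apply: mg => //; apply: measurableC.
  rewrite -[X in measurable X]setTI.
  suff h : measurable_fun setT (fun q : mR * mR => (q.1, q.2 * (g q)^-1) : mR * mR).
    by apply: h => //; exact: measurable_Omega.
  apply: measurable_fun_pair => //; apply: measurable_funM => //.
  exact: measurableT_comp measurable_invr mg.
by apply/seteqP; split => q /= [/eqP h1 h2]; split => //; apply/eqP.
Qed.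

Lemma measurable_pt (s : R) :
  measurable_fun setT (fun p : mR * mR => pt (p, s) : T1M R).
Proof.
pose f (p : mR * mR) := entries (Asl2 s p.1 p.2).
have mf : measurable_fun setT f.
  have mxy : measurable_fun setT (fun p : mR * mR => 1 - p.1 * p.2 : mR).
    by apply: measurable_funB => //; apply: measurable_funM.
  have mx : measurable_fun setT (fun p : mR * mR => - p.1 : mR).
    exact: measurableT_comp.
  have [/eqP s1|s1] := boolP (s == 1).
    rewrite (_ : f = fun p => (p.1, 1 - p.1 * p.2, -1, p.2)).
      by do 3 apply: measurable_fun_pair => //.
    by apply/funext => p; rewrite /f /entries /= /Amx s1 eqxx !mxE.
  rewrite (_ : f = fun p => (1, p.2, - p.1, 1 - p.1 * p.2)).
    by do 3 apply: measurable_fun_pair => //.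
  by apply/funext => p; rewrite /f /entries /= /Amx (negbTE s1) !mxE.
move=> _ B [C mC CE].
rewrite (_ : _ @^-1` B = f @^-1` C); first exact: mf.
suff h A : B (cls A) <-> C (entries A) by apply/seteqP; split => p /= /h.
have /seteqP[s1 s2] := CE.
by split=> [/(conj Logic.I)/(s2 A)[]|/(conj Logic.I)/(s1 A)[]].
Qed.

End MeasurableStructure.

Section InducedMeasure.
Context {R : realType}.
Local Notation mR := (measurableTypeR R).

Definition lebesgue2 : {measure set (mR * mR) -> \bar R} :=
  (@lebesgue_measure R \x @lebesgue_measure R)%E.

Definition ell_sheet (alpha s : R) : set (T1M R) -> \bar R :=
  pushforward (mrestr lebesgue2 (measurable_Sigma alpha))
    (fun p : mR * mR => pt (p, s)).

Let ell_sheet0 alpha s : ell_sheet alpha s set0 = 0%E.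
Proof. by apply: measure0; exact: measurable_pt. Qed.

Let ell_sheet_ge0 alpha s B : (0 <= ell_sheet alpha s B)%E.
Proof. by apply: measure_ge0; exact: measurable_pt. Qed.

Let ell_sheet_sigma_additive alpha s : semi_sigma_additive (ell_sheet alpha s).
Proof. by apply: measure_semi_sigma_additive; exact: measurable_pt. Qed.

HB.instance Definition _ (alpha s : R) := isMeasure.Build _ _ _
  (ell_sheet alpha s) (ell_sheet0 alpha s) (ell_sheet_ge0 alpha s)
  (@ell_sheet_sigma_additive alpha s).

(* Almost every class has at most one label (x, y, s), so this sum of image *)
(* measures is dx dy on each of the two sheets.                             *)
Definition ell (alpha : R) : {measure set (T1M R) -> \bar R} :=
  measure_add (ell_sheet alpha (-1)) (ell_sheet alpha 1).

End InducedMeasure.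

(* Main.v *)
Require Import Defs.
From mathcomp Require Import all_boot all_order all_algebra.
From mathcomp Require Import all_classical all_reals all_analysis.
From mathcomp Require Import measurable_realfun.
From mathcomp Require Import zify ring lra.

Set Implicit Arguments.
Unset Strict Implicit.
Unset Printing Implicit Defensive.

Import Order.TTheory GRing.Theory Num.Theory.
Import numFieldNormedType.Exports.

Local Open Scope classical_set_scope.
Local Open Scope ring_scope.

(** View a class as the lattice spanned by the rows of a representative. The
    label (x, y, s) says that the lattice contains w0 = (1, - s y), completed to
    a basis by w1 = (- x, - s (1 - x y)); flowing until the first coordinate of
    w1 has absolute value 1 makes w1 the new marked vector, up to sign, and this
    realizes Phi. Following preimages of the natural extension inside Omega,
    every label yields a backward sequence of vectors of its lattice, with
    first coordinates tending to infinity. As 1 + X Y >= alpha on Omega, this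
    sequence meets the line of every lattice vector (u, v) with u large and
    |u v| < alpha / 4. By Lebesgue's density theorem almost every lattice has
    such vectors, so the backward sequences of two labels lying on one flow
    line share a vector, hence a label, and from there on they agree. So every
    label met on the flow line is an iterate of the given one under Phi, in the
    past or in the future, and no return occurs before Phi. Excluding
    coordinates in the countable field Q(alpha), which is stable under integral
    Moebius maps, avoids the discontinuities of the natural extension and makes
    labels unique. *)

(** * The countable field Q(alpha) *)

Section GeneratedSubfield.
Context {R : realType} (alpha : R).

Let ev (p : {poly int}) : R := (map_poly intr p).[alpha].

(* As x / 0 = 0, a vanishing denominator only contributes 0. *)
Definition Qadj : set R := range (fun pq => ev pq.1 / ev pq.2).

Let evD p q : ev (p + q) = ev p + ev q.
Proof. by rewrite /ev rmorphD hornerD. Qed.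

Let evM p q : ev (p * q) = ev p * ev q.
Proof. by rewrite /ev rmorphM hornerM. Qed.

Let evC n : ev n%:P = n%:~R.
Proof. by rewrite /ev map_polyC hornerC. Qed.

Lemma countable_Qadj : countable Qadj.
Proof. exact/(sub_countable (card_image_le _ _))/countableP. Qed.

Lemma Qadj_int n : Qadj n%:~R.
Proof. by exists (n%:P, 1%:P) => //=; rewrite !evC divr1. Qed.

Lemma Qadj_gen : Qadj alpha.
Proof.
exists ('X, 1%:P) => //=.
by rewrite evC divr1 /ev map_polyX hornerX.
Qed.

Lemma QadjV x : Qadj x -> Qadj x^-1.
Proof. by move=> [[p q] _ <-]; exists (q, p); rewrite //= invf_div. Qed.

Lemma QadjM x y : Qadj x -> Qadj y -> Qadj (x * y).
Proof.
move=> [[p q] _ <-] [[p' q'] _ <-]; exists (p * p', q * q') => //=.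
by rewrite !evM mulf_div.
Qed.

Lemma QadjD x y : Qadj x -> Qadj y -> Qadj (x + y).
Proof.
move=> [[p q] _ <-] [[p' q'] _ <-] /=.
have [->|q0] := eqVneq (ev q) 0.
  by rewrite invr0 mulr0 add0r; exists (p', q').
have [->|q'0] := eqVneq (ev q') 0.
  by rewrite invr0 mulr0 addr0; exists (p, q).
by exists (p * q' + p' * q, q * q') => //=; rewrite evD !evM addf_div.
Qed.

Lemma QadjN x : Qadj x -> Qadj (- x).
Proof. by rewrite -mulN1r; apply: QadjM; exact: (Qadj_int (- 1)). Qed.

Lemma QadjB x y : Qadj x -> Qadj y -> Qadj (x - y).
Proof. by move=> ? /QadjN; exact: QadjD. Qed.

Lemma Qadj0 : Qadj 0. Proof. exact: (Qadj_int 0). Qed.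
Lemma Qadj1 : Qadj 1. Proof. exact: (Qadj_int 1). Qed.

Lemma Qadj_eps x : Qadj (eps x).
Proof. by rewrite /eps; case: ifP => _; [exact: Qadj1|exact/QadjN/Qadj1]. Qed.

End GeneratedSubfield.

(** * Unimodular lattices attached to classes, and the action of the flow on them *)

Section Lattice.
Context {R : realType}.
Implicit Types (A B : SL2 R) (w : R * R) (s t x y : R).

Lemma ord2P (i : 'I_2) : i = 0 \/ i = 1.
Proof. by case: i => [[|[|//]] ?]; [left|right]; exact/val_inj. Qed.

(** Left multiplication by an element of SL_2(Z) only changes the basis, so this set depends on the
    class alone ([lat_cls]). *)
Definition lat A : set (R * R) := [set w | exists a b : int,
  w.1 = a%:~R * val A 0 0 + b%:~R * val A 1 0 /\
  w.2 = a%:~R * val A 0 1 + b%:~R * val A 1 1].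

Definition cross w w' : R := w.1 * w'.2 - w.2 * w'.1.

Lemma mx2E (M : 'M[R]_2) : M = mx2 (M 0 0) (M 0 1) (M 1 0) (M 1 1).
Proof.
by apply/matrixP => i j; rewrite !mxE; have [->|->] := ord2P i;
  have [->|->] := ord2P j.
Qed.

Lemma det_sl2E A : val A 0 0 * val A 1 1 - val A 0 1 * val A 1 0 = 1.
Proof. by rewrite -det_mx2 -mx2E; exact: det_sl2. Qed.

(** Covolume 1 makes these determinants integers, so one of absolute value below 1 must vanish. *)
Lemma lat_cross A w w' : lat A w -> lat A w' -> exists n : int, cross w w' = n%:~R.
Proof.
move=> [a [b [w1 w2]]] [c [d [w1' w2']]]; exists (a * d - b * c).
rewrite rmorphB !rmorphM /= -[RHS]mulr1 -[X in _ = _ * X](det_sl2E A) /cross w1 w2 w1' w2'.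
ring.
Qed.

Lemma latB A w w' : lat A w -> lat A w' -> lat A (w.1 - w'.1, w.2 - w'.2).
Proof.
move=> [a [b [w1 w2]]] [c [d [w1' w2']]]; exists (a - c), (b - d) => /=.
by rewrite !rmorphB /= w1 w2 w1' w2'; split; ring.
Qed.

Lemma int_matrix2 (M : 'M[int]_2) (A B : 'M[R]_2) : B = map_mx intr M *m A ->
  forall i j, B i j = (M i 0)%:~R * A 0 j + (M i 1)%:~R * A 1 j.
Proof.
move=> -> i j; rewrite !mxE !big_ord_recl big_ord0 addr0 !mxE.
by congr (_ * A _ _ + (M _ _)%:~R * A _ _); exact/val_inj.
Qed.

Lemma lat_cls A B : cls A = cls B -> lat A `<=` lat B.
Proof.
move=> /esym/clsP[M [dM /int_matrix2 AE]] w [a [b [w1 w2]]].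
exists (a * M 0 0 + b * M 1 0), (a * M 0 1 + b * M 1 1).
by rewrite !rmorphD !rmorphM /= w1 w2 !AE; split; ring.
Qed.

Lemma geodE A t i : val (sl2_mul A (geod t)) i 0 = val A i 0 * expR (t / 2)
  /\ val (sl2_mul A (geod t)) i 1 = val A i 1 * expR (- (t / 2)).
Proof.
rewrite /= !mxE !big_ord_recl !big_ord0 !mxE /= !mulr0 !addr0 add0r.
by split=> //; congr (val A _ _ * _); exact/val_inj.
Qed.

Lemma lat_geod A t w : lat A w ->
  lat (sl2_mul A (geod t)) (w.1 * expR (t / 2), w.2 * expR (- (t / 2))).
Proof.
move=> [a [b [w1 w2]]]; exists a, b => /=.
have [-> ->] := geodE A t 0; have [-> ->] := geodE A t 1.
by rewrite w1 w2; split; ring.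
Qed.

Lemma AmxN1 x y : Amx (-1) x y = mx2 1 y (- x) (1 - x * y).
Proof. by rewrite /Amx ifF //; apply/eqP; lra. Qed.

Lemma Amx1 x y : Amx 1 x y = mx2 x (1 - x * y) (-1) y.
Proof. by rewrite /Amx eqxx. Qed.

(** The vector w0 of the overview, up to sign a row of [Amx]; [lat_Asl2_2] treats w1. *)
Lemma lat_Asl2_1 s x y : s = -1 \/ s = 1 -> lat (Asl2 s x y) (1, - (s * y)).
Proof.
case=> ->; rewrite /lat /= ?AmxN1 ?Amx1.
  by exists 1, 0; rewrite !mxE /=; split; ring.
by exists 0, (- 1); rewrite !mxE /= rmorphN; split; ring.
Qed.

Lemma lat_Asl2_2 s x y : s = -1 \/ s = 1 ->
  lat (Asl2 s x y) (- x, - (s * (1 - x * y))).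
Proof.
case=> ->; rewrite /lat /= ?AmxN1 ?Amx1.
  by exists 0, 1; rewrite !mxE /=; split; ring.
by exists (- 1), 0; rewrite !mxE /= rmorphN; split; ring.
Qed.

Lemma flow0 v : flow (0 : R) v = v.
Proof.
rewrite /flow -[RHS]reprK; congr cls; apply/val_inj => /=.
rewrite (_ : mx2 _ _ _ _ = 1%:M) ?mulmx1 //.
apply/matrixP => i j; rewrite !mxE mul0r oppr0 expR0.
by have [->|->] := ord2P i; have [->|->] := ord2P j.
Qed.

Lemma flowD t t' v : flow (t + t') v = flow t (flow t' v).
Proof.
rewrite [flow t' v]/flow flow_cls; congr cls; apply/val_inj => /=.
rewrite -mulmxA; congr (_ *m _); apply/matrixP => i j.
rewrite !mxE !big_ord_recl !big_ord0 !mxE /= mulrDl opprD !expRD.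
by have [->|->] := ord2P i; have [->|->] := ord2P j => /=; ring.
Qed.

End Lattice.

(** * Generic classes, uniqueness of labels, and the flow time that realizes [Phi] *)

Section GenericClasses.
Context {R : realType} (alpha : R).
Implicit Types (A B : SL2 R) (s t x y : R).

Definition Qindep u v := forall c d, Qadj alpha c -> Qadj alpha d ->
  c * u + d * v = 0 -> c = 0 /\ d = 0.

(** Integral row operations of determinant 1 preserve independence of a column over Q(alpha), and
    the flow only rescales columns, so genericity is a property of a whole flow line in the
    quotient. *)
Definition generic A :=
  Qindep (val A 0 0) (val A 1 0) /\ Qindep (val A 0 1) (val A 1 1).

Lemma generic_cls A B : cls A = cls B -> generic A -> generic B.
Proof.
move=> /clsP[M [dM /int_matrix2 BE]] [g0 g1].
have dM' : (M 0 0)%:~R * (M 1 1)%:~R - (M 0 1)%:~R * (M 1 0)%:~R = 1 :> R.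
  have := congr1 (fun n : int => n%:~R : R) dM; rewrite -det_map_mx.
  by rewrite [map_mx _ _]mx2E det_mx2 !mxE.
suff gc j : Qindep (val A 0 j) (val A 1 j) -> Qindep (val B 0 j) (val B 1 j).
  by split; exact: gc.
move=> g c d Kc Kd; rewrite !BE => h.
have KM i k := Qadj_int alpha (M i k).
have [|||e0 e1] := g (c * (M 0 0)%:~R + d * (M 1 0)%:~R)
  (c * (M 0 1)%:~R + d * (M 1 1)%:~R).
- by apply: QadjD; exact: QadjM.
- by apply: QadjD; exact: QadjM.
- by rewrite -[RHS]h; ring.
(* The combinations of c and d in [e0] and [e1] vanish; inverting M by means of [dM'] recovers c and
   d. *)
split.
- rewrite -[LHS]mulr1 -[X in _ * X = _]dM'.
  transitivity ((c * (M 0 0)%:~R + d * (M 1 0)%:~R) * (M 1 1)%:~R -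
    (c * (M 0 1)%:~R + d * (M 1 1)%:~R) * (M 1 0)%:~R); first by ring.
  by rewrite e0 e1 !mul0r subrr.
- rewrite -[LHS]mulr1 -[X in _ * X = _]dM'.
  transitivity ((c * (M 0 1)%:~R + d * (M 1 1)%:~R) * (M 0 0)%:~R -
    (c * (M 0 0)%:~R + d * (M 1 0)%:~R) * (M 0 1)%:~R); first by ring.
  by rewrite e0 e1 !mul0r subrr.
Qed.

Lemma Qindep_scale u v k : k != 0 -> Qindep u v -> Qindep (u * k) (v * k).
Proof.
move=> k0 g c d Kc Kd h; apply: g => //; apply: (mulIf k0).
by rewrite mul0r -h; ring.
Qed.

Lemma generic_geod A t : generic A -> generic (sl2_mul A (geod t)).
Proof.
rewrite /generic; have [-> ->] := geodE A t 0; have [-> ->] := geodE A t 1.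
by move=> [g0 g1]; split; apply: Qindep_scale => //; rewrite gt_eqF ?expR_gt0.
Qed.

Lemma Qindep1P x : Qindep 1 x <-> ~ Qadj alpha x.
Proof.
split=> [g Kx|Kx c d Kc Kd h].
  have [|||_ /eqP] := g x (- 1) => //; first exact/QadjN/Qadj1.
    by ring.
  by rewrite oppr_eq0 oner_eq0.
have [d0|d0] := eqVneq d 0; first by move: h; rewrite d0 mul0r addr0 mulr1.
exfalso; apply: Kx; rewrite (_ : x = - c / d); last first.
  by apply: (mulIf d0); rewrite divfK //; lra.
by apply: QadjM; [exact: QadjN|exact: QadjV].
Qed.

Lemma QindepC u v : Qindep u v -> Qindep v u.
Proof. by move=> g c d Kc Kd; rewrite addrC => /g[]. Qed.

Lemma QindepN u v : Qindep u v -> Qindep (- u) v.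
Proof.
move=> g c d Kc Kd h; have [|||/eqP] := g (- c) d => //; first exact: QadjN.
  by rewrite -[RHS]h; ring.
by rewrite oppr_eq0 => /eqP.
Qed.

Lemma Qindep_div u v : v != 0 -> Qindep u v <-> ~ Qadj alpha (u / v).
Proof.
move=> v0; rewrite -Qindep1P; split => [/(Qindep_scale (invr_neq0 v0))|].
  by rewrite divff // => /QindepC.
by move=> /(Qindep_scale v0); rewrite divfK // mul1r => /QindepC.
Qed.

(** Up to sign and inversion, the columns of [Amx s x y] have ratios x and y / (1 - x y); the latter
    is the second coordinate before [Zmap]. *)
Lemma generic_Asl2 s x y : s = -1 \/ s = 1 -> 1 - x * y != 0 ->
  generic (Asl2 s x y) <-> ~ Qadj alpha x /\ ~ Qadj alpha (y / (1 - x * y)).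
Proof.
move=> hs xy0; rewrite -(Qindep_div y xy0) -Qindep1P.
rewrite /generic /=; case: hs => ->; rewrite ?AmxN1 ?Amx1 !mxE /=.
  split=> -[g0 g1]; split => //; last exact/QindepC/QindepN/QindepC.
  by rewrite -[x]opprK; exact/QindepC/QindepN/QindepC.
split=> -[g0 g1]; split; try exact/QindepC.
  by rewrite -[1]opprK; exact/QindepN/QindepC.
exact/QindepC/QindepN.
Qed.

(** The vectors w0 of both labels have first coordinate 1, and by genericity 0 is the only lattice
    vector with first coordinate 0. Hence s y = s' y', and y > 0 separates the sign from y. *)
Lemma label_unique x y s x' y' s' :
  s = -1 \/ s = 1 -> s' = -1 \/ s' = 1 ->
  alpha - 1 <= x <= alpha -> alpha - 1 <= x' <= alpha -> 0 <= y -> 0 <= y' ->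
  1 - x * y != 0 -> generic (Asl2 s x y) -> pt (x, y, s) = pt (x', y', s') ->
  (x, y, s) = (x', y', s').
Proof.
move=> hs hs' hx hx' y0 y'0 xy0 g e.
have [Kx Ky] := (generic_Asl2 hs xy0).1 g.
have l1 := lat_Asl2_1 x y hs; have l2 := lat_Asl2_2 x y hs.
have l1' := lat_cls (esym e) (lat_Asl2_1 x' y' hs').
have l2' := lat_cls (esym e) (lat_Asl2_2 x' y' hs').
have yn0 : y != 0.
  by apply/eqP => y00; apply: Ky; rewrite y00 mul0r; exact: Qadj0.
have sy : s * y = s' * y'.
  have [a [b /= [h1 h2]]] := latB l1' l1.
  have [|||a0 b0] := g.1 a%:~R b%:~R; try exact: Qadj_int.
    by rewrite -h1 subrr.
  by move: h2; rewrite a0 b0 !mul0r addr0 => ?; lra.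
have [ss yy] : s = s' /\ y = y'.
  by case: hs sy => ->; case: hs' => ->; nra.
subst s' y'.
suff <- : x = x' by [].
(* The two second basis vectors differ by (x - x') times the first one, so
   x - x' is an integer; it can be nonzero only if {x, x'} = {alpha - 1, alpha}. *)
have [n hn] := lat_cross (latB l2' l2) l2.
have xn : x - x' = n%:~R \/ x' - x = n%:~R.
  move: hn; rewrite /cross /=; case: hs => ->; nra.
have Kb b : x != alpha + b%:~R.
  apply/eqP => xb; apply: Kx; rewrite xb.
  by apply: QadjD; [exact: Qadj_gen|exact: Qadj_int].
have := Kb 0; have := Kb (-1); rewrite intrN addr0 => k1 k0.
have /andP[n1 n2] : -1 < n < 1.
  rewrite -!(ltr_int R) intrN.
  move: hx k1 k0 hx'; rewrite !lt_def; case: xn => <-; lra.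
have : n = 0 by lia.
by move=> n0; move: xn; rewrite n0 => -[]; lra.
Qed.

Lemma eq_cls (a b c d : int) A B : a * d - b * c = 1 ->
  (forall j, val B 0 j = a%:~R * val A 0 j + b%:~R * val A 1 j) ->
  (forall j, val B 1 j = c%:~R * val A 0 j + d%:~R * val A 1 j) ->
  cls A = cls B.
Proof.
move=> abcd B0 B1; apply/clsP.
exists (\matrix_(i, j) (if i == 0 then if j == 0 then a else b
                        else if j == 0 then c else d)).
split.
  rewrite (expand_det_row _ 0) !big_ord_recl big_ord0 /cofactor !det_mx11 !mxE /=.
  by rewrite /bump /= expr0 expr1 !mul1r mulN1r addr0 mulrN.
apply/matrixP => i j; rewrite !mxE !big_ord_recl big_ord0 addr0 !mxE.
rewrite (_ : lift ord0 ord0 = 1); last exact/val_inj.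
by have [->|->] := ord2P i; rewrite ?B0 ?B1.
Qed.

Local Ltac flow_entries x0 g1 g2 normE :=
  let j := fresh "j" in
  move=> j; have [->|->] := ord2P j;
  rewrite ?(geodE _ _ _).1 ?(geodE _ _ _).2 ?g1 ?g2 /= ?AmxN1 ?Amx1 !mxE /=;
  rewrite ?normfV normE ?intrN; field; rewrite ?x0.

(** After this time the first coordinate of w1 is 1 or -1. For each s and each sign of x, an
    integral matrix containing the digit d carries the flowed representative to that of the new
    label. *)
Lemma flow_Phi x y s : s = -1 \/ s = 1 -> x != 0 ->
  flow (- (ln `|x| *+ 2)) (pt (x, y, s)) = pt (Phi alpha (x, y, s)).
Proof.
move=> hs x0; rewrite /pt flow_cls.
pose d := Num.floor (`|x^-1| + 1 - alpha).
have n0 : 0 < `|x| by rewrite normr_gt0.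
have e1 : - (ln `|x| *+ 2) / 2 = - ln `|x| by rewrite -mulr_natr; field.
have g1 : expR (- (ln `|x| *+ 2) / 2) = `|x|^-1 by rewrite e1 expRN lnK.
have g2 : expR (- (- (ln `|x| *+ 2) / 2)) = `|x| by rewrite e1 opprK lnK.
rewrite /Phi /Tmap (negbTE x0) /= /digit -/d /eps.
case: hs => ->; have [x0'|x0'] := leP 0 x; rewrite !(mulrN1, mulN1r, opprK, mul1r, mulr1).
- by apply: (@eq_cls 1 d 0 1); [lia|flow_entries x0 g1 g2 (ger0_norm x0')..].
- by apply: (@eq_cls 0 1 (- 1) d); [lia|flow_entries x0 g1 g2 (ltr0_norm x0')..].
- by apply: (@eq_cls 1 0 d 1); [lia|flow_entries x0 g1 g2 (ger0_norm x0')..].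
- by apply: (@eq_cls d (- 1) 1 0); [lia|flow_entries x0 g1 g2 (ltr0_norm x0')..].
Qed.

End GenericClasses.

(** * The natural extension on [Omega]: continuity, images and preimages of regular points *)

Section NaturalExtension.
Context {R : realType} (alpha : R) (alpha01 : 0 < alpha <= 1).
Implicit Types (x y z : R) (p q : R * R).

Lemma eps_sqr x : eps x * eps x = 1.
Proof. by rewrite /eps; case: ifP => _; rewrite ?mulN1r ?opprK ?mulr1. Qed.

Lemma epsE x : eps x = -1 \/ eps x = 1.
Proof. by rewrite /eps; case: ifP => _; [right|left]. Qed.

Lemma eps_norm x : eps x * `|x| = x.
Proof.
rewrite /eps; case: leP => x0; first by rewrite mul1r ger0_norm.
by rewrite mulN1r ltr0_norm // opprK.
Qed.

Lemma eps_mul x : eps x * x = `|x|.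
Proof. by rewrite -{2}(eps_norm x) mulrA eps_sqr mul1r. Qed.

Lemma Tmap_bounds x : alpha - 1 <= Tmap alpha x < alpha.
Proof.
rewrite /Tmap; case: eqP => _; first by move: alpha01; lra.
rewrite /digit; set t := _ + 1 - alpha.
have := floor_le_tmp t; have := floorD1_gt t; rewrite intrD /t; lra.
Qed.

(** For x < 0, |x| (1 + alpha) <= 1 - alpha^2 < 1, whence the bound 2; it compensates the sign -1 in
    the denominator of [natext]. *)
Lemma digit_ge1 x : x != 0 -> alpha - 1 <= x <= alpha ->
  1 <= digit alpha x /\ (x < 0 -> 2 <= digit alpha x).
Proof.
move=> x0 hx; rewrite /digit.
have n0 : 0 < `|x| by rewrite normr_gt0.
have h : `|x| * `|x^-1| = 1 by rewrite normfV divff // gt_eqF.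
rewrite (ler_int R 1) (ler_int R 2) !floor_ge_int_tmp.
have [x0'|x0'] := leP 0 x; split => //=.
- by move: n0 h hx alpha01; rewrite (ger0_norm x0'); nra.
- by move: n0 h hx alpha01; rewrite (ltr0_norm x0'); nra.
- by move: n0 h hx alpha01; rewrite (ltr0_norm x0'); nra.
Qed.

(** A closed rectangle that [natext] maps into itself, hence a crude bound for [Omega]. *)
Definition strip : set (R * R) := [set p | alpha - 1 <= p.1 <= alpha /\ 0 <= p.2 <= 1].

Lemma denom_ge1 p : p.1 != 0 -> strip p -> 1 <= digit alpha p.1 + eps p.1 * p.2.
Proof.
move=> x0 [hx hy]; have [d1 d2] := digit_ge1 x0 hx; rewrite /eps.
have [h|h] := leP 0 p.1; first lra.
by have := d2 h; lra.
Qed.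

Lemma natext_strip p : strip p -> strip (natext alpha p).
Proof.
move=> sp; rewrite /natext; case: eqP => [_|/eqP x0].
  by split => /=; move: alpha01; lra.
split => /=; first by have := Tmap_bounds p.1; lra.
have d1 := denom_ge1 x0 sp.
by rewrite invr_ge0 invf_le1 ?(lt_le_trans ltr01) // d1 (le_trans ler01).
Qed.

Definition orbits : set (R * R) := [set p | exists (n : nat) x,
    alpha - 1 <= x <= alpha /\ p = iter n (natext alpha) (x, 0)].

Lemma orbits_strip : orbits `<=` strip.
Proof.
move=> _ [n [x [hx ->]]]; elim: n => [|n IH] /=; last exact: natext_strip.
by split => //=; rewrite lexx ler01.
Qed.

Lemma closed_strip : closed strip.
Proof.
have -> : strip = fst @^-1` [set` `[alpha - 1, alpha]] `&`
                  snd @^-1` [set` `[0 : R, 1]].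
  by apply/seteqP; split => p [] /=; rewrite !in_itv /=.
apply: closedI; apply: preimage_closed; try exact: interval_closed.
  by move=> p _; exact: cvg_fst.
by move=> p _; exact: cvg_snd.
Qed.

Lemma Omega_strip : Omega alpha `<=` strip.
Proof.
rewrite [X in _ `<=` X](closure_id _).1; last exact: closed_strip.
exact: (closure_subset orbits_strip).
Qed.

Lemma Qadj_norm x : Qadj alpha `|x| <-> Qadj alpha x.
Proof.
rewrite -{2}(eps_norm x); split; first exact/QadjM/Qadj_eps.
by move=> h; rewrite -[`|x|]mul1r -(eps_sqr x) -mulrA; exact/QadjM/h/Qadj_eps.
Qed.

(** Away from x = 0, [natext] acts on each coordinate by an integral Moebius map, up to a sign, so
    membership in Q(alpha) passes in both directions. *)
Lemma Qadj_natext1 p : p.1 != 0 ->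
  Qadj alpha p.1 <-> Qadj alpha (natext alpha p).1.
Proof.
move=> x0; rewrite /natext /Tmap (negbTE x0) /= ?(negbTE x0) /digit; split.
  move=> h; apply: QadjB; last exact: Qadj_int.
  exact/Qadj_norm/QadjV.
move=> h; rewrite -[p.1]invrK; apply/QadjV/Qadj_norm.
rewrite -[`|_|](subrK (Num.floor (`|p.1^-1| + 1 - alpha))%:~R).
by apply: QadjD => //; exact: Qadj_int.
Qed.

Lemma Qadj_natext2 p : p.1 != 0 ->
  Qadj alpha p.2 <-> Qadj alpha (natext alpha p).2.
Proof.
move=> x0; rewrite /natext (negbTE x0) /= /digit; split.
  move=> h; apply/QadjV/QadjD; first exact: Qadj_int.
  exact/QadjM/h/Qadj_eps.
move=> /QadjV; rewrite invrK => h.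
rewrite -[p.2]mul1r -(eps_sqr p.1) -mulrA; apply: QadjM; first exact: Qadj_eps.
have -> : eps p.1 * p.2 = (Num.floor (`|p.1^-1| + 1 - alpha))%:~R + eps p.1 * p.2 -
   (Num.floor (`|p.1^-1| + 1 - alpha))%:~R by ring.
by apply: QadjB => //; exact: Qadj_int.
Qed.

(** The digit jumps only where |1/x| lies in alpha + Z, and the sign only at 0. These x lie in
    Q(alpha), so [natext] is continuous at regular points. The condition on the second coordinate
    makes the classes generic. *)
Definition regular : set (R * R) :=
  [set p | Omega alpha p /\ ~ Qadj alpha p.1 /\ ~ Qadj alpha p.2].

Lemma Qadj_neq0 x : ~ Qadj alpha x -> x != 0.
Proof. by move=> h; apply/eqP => x0; apply: h; rewrite x0; exact: Qadj0. Qed.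

Lemma orbits_natext p : orbits p -> orbits (natext alpha p).
Proof. by move=> [n [x [hx ->]]]; exists n.+1, x. Qed.

Lemma floor_near x : ~ Qadj alpha x -> \forall z \near x,
  Num.floor (`|z^-1| + 1 - alpha) = Num.floor (`|x^-1| + 1 - alpha).
Proof.
move=> Kx; set m := Num.floor (`|x^-1| + 1 - alpha).
have c : `|z^-1| + 1 - alpha @[z --> x] --> `|x^-1| + 1 - alpha.
  apply: cvgB; last exact: cvg_cst.
  apply: cvgD; last exact: cvg_cst.
  by apply: cvg_norm; exact/inv_continuous/Qadj_neq0.
have m1 : m%:~R < `|x^-1| + 1 - alpha.
  rewrite lt_neqAle floor_le_tmp andbT; apply/eqP => e; apply: Kx.
  rewrite -[x]invrK; apply/QadjV/Qadj_norm.
  rewrite (_ : `|x^-1| = m%:~R - 1 + alpha); last by rewrite e; ring.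
  apply: QadjD; last exact: Qadj_gen.
  by apply: QadjB; [exact: Qadj_int|exact: Qadj1].
have m2 := floorD1_gt (`|x^-1| + 1 - alpha).
near=> z; apply: floor_def; apply/andP; split.
  near: z; apply: filterS (cvgr_gt _ c _ m1) => z; exact: ltW.
by near: z; exact: cvgr_lt c _ m2.
Unshelve. all: by end_near. Qed.

Lemma eps_near x : x != 0 -> \forall z \near x, eps z = eps x.
Proof.
move=> x0; rewrite /eps; case: leP => h.
  have {}x0 : 0 < x by rewrite lt_def x0.
  by apply: filterS (cvgr_gt _ (@cvg_id _ (nbhs x)) _ x0) => z /ltW ->.
apply: filterS (cvgr_lt _ (@cvg_id _ (nbhs x)) _ h) => z z0.
by rewrite leNgt z0.
Qed.

(** Near p the digit and the sign are constant, so [natext] agrees with the continuous [f] and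
    carries orbit points close to p to orbit points close to its image. *)
Lemma regular_natext p : regular p -> regular (natext alpha p).
Proof.
move=> [Op [K1 K2]]; have x0 := Qadj_neq0 K1.
split; last by rewrite -Qadj_natext1 // -Qadj_natext2.
pose f q : R * R := (`|q.1^-1| - (Num.floor (`|p.1^-1| + 1 - alpha))%:~R,
  ((Num.floor (`|p.1^-1| + 1 - alpha))%:~R + eps p.1 * q.2)^-1).
have fst_near (P : set R) : (\forall z \near p.1, P z) -> \forall q \near p, P q.1.
  exact: (@cvg_fst _ _ (nbhs p.1) (nbhs p.2)).
have nf : \forall q \near p, natext alpha q = f q.
  have n1 : \forall q \near p, q.1 != 0.
    apply: (fst_near (fun z => z != 0)).
    exact: (cvgr_neq0 _ (@cvg_id _ (nbhs p.1)) x0).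
  have n2 := fst_near _ (floor_near K1).
  have n3 := fst_near _ (eps_near x0).
  apply: (filterS _ (filterI n1 (filterI n2 n3))) => q [/= q0 [e2 e3]].
  by rewrite /natext /Tmap (negbTE q0) /= ?(negbTE q0) /digit /f e2 e3.
have cf : f q @[q --> p] --> f p.
  apply: (@cvg_pair _ _ _ (nbhs p) (nbhs (f p).1) (nbhs (f p).2) _ _ _
    (fun q => (f q).1) (fun q => (f q).2)).
    apply: cvgB; last exact: cvg_cst.
    by apply: cvg_norm; apply: cvgV => //; exact: cvg_fst.
  apply: cvgV.
    by rewrite gt_eqF // (lt_le_trans ltr01) //; apply/denom_ge1/Omega_strip.
  apply: cvgD; first exact: cvg_cst.
  by apply: cvgM; [exact: cvg_cst|exact: cvg_snd].
have fp := nbhs_singleton nf; rewrite fp => B nB.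
have nB' : nbhs p (f @^-1` B) := cf _ nB.
have [q [Sq [/= Bq qf]]] := Op _ (filterI nB' nf).
by exists (natext alpha q); split; [exact: orbits_natext|rewrite qf].
Qed.

Definition branch_inv (e : R) (m : nat) q : R * R :=
  (e / (q.1 + m%:R), e * (q.2^-1 - m%:R)).

Lemma natext_branch_inv e m q : e = -1 \/ e = 1 -> 0 < q.1 + m%:R ->
  alpha - 1 <= q.1 < alpha -> natext alpha (branch_inv e m q) = q.
Proof.
move=> he h0 hq; rewrite /natext /branch_inv /=.
have ne : `|e| = 1 by case: he => ->; rewrite ?normrN normr1.
have -> : eps (e / (q.1 + m%:R)) = e.
  rewrite /eps pmulr_lge0 ?invr_gt0 //.
  by case: he => ->; [rewrite ifF //; apply/negbTE; rewrite -ltNge; lra|rewrite ler01].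
have n0 : e / (q.1 + m%:R) != 0.
  apply: mulf_neq0; first by case: he => ->; rewrite ?oppr_eq0 oner_eq0.
  by rewrite invr_eq0 gt_eqF.
rewrite (negbTE n0) /Tmap (negbTE n0) /digit.
have -> : `|(e / (q.1 + m%:R))^-1| = q.1 + m%:R.
  by rewrite normfV normrM ne mul1r normfV invrK gtr0_norm.
have -> : Num.floor (q.1 + m%:R + 1 - alpha) = m.
  by apply: floor_def; rewrite intrD /= -!pmulrn; lra.
rewrite -pmulrn addrK mulrA (_ : e * e = 1); last by case: he => ->; ring.
by rewrite mul1r addrC subrK invrK; case: q {h0 hq n0}.
Qed.

(** The last bound comes from (natext q).2^-1 = m + q.2 or m - q.2 with q.2 <= 1. It leaves finitely
    many digits when the second coordinate of the image is bounded below. *)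
Lemma branch_inv_natext q : strip q -> q.1 != 0 ->
  exists m : nat, [/\ (0 < m)%N, branch_inv (eps q.1) m (natext alpha q) = q
    & m%:R <= (natext alpha q).2^-1 + 1].
Proof.
move=> sq q0; have [d1 _] := digit_ge1 q0 sq.1.
have [m dm] : exists m : nat, digit alpha q.1 = m%:R.
  move: d1; rewrite /digit; case: (Num.floor _) => m; first by exists m.
  by rewrite (ler_int R 1).
exists m; rewrite /natext /Tmap /branch_inv !(negbTE q0) /= ?(negbTE q0) dm.
rewrite invrK; split; first by rewrite -(ltr_nat R) -dm; lra.
  rewrite subrK addrAC subrr add0r mulrA eps_sqr mul1r normfV invrK eps_norm.
  by case: q {sq q0 d1 dm}.
by have [h|h] := epsE q.1; rewrite h; case: sq => _; lra.
Qed.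

(* Near p the second coordinate stays away from 0, so the digits of the
   preimages are bounded: only finitely many inverse branches matter, and one
   of them must send p to a limit of orbits. *)
Lemma regular_preimage p : regular p ->
  exists2 q, regular q & natext alpha q = p.
Proof.
move=> [Op [K1 K2]].
have [/andP[hX1 hX2] /andP[hY1 hY2]] := Omega_strip Op.
have hX3 : p.1 < alpha.
  rewrite lt_neqAle hX2 andbT; apply/eqP => e; apply: K1; rewrite e.
  exact: Qadj_gen.
have hY : 0 < p.2 by rewrite lt_def hY1 Qadj_neq0.
suff [e [m [he m0 Oi]]] : exists e m, [/\ e = -1 \/ e = 1, (0 < m)%N &
    Omega alpha (branch_inv e m p)].
  have np : natext alpha (branch_inv e m p) = p.
    apply: natext_branch_inv => //; last by rewrite hX1.
    by have : 1 <= m%:R :> R by [rewrite ler1n]; move: alpha01; lra.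
  exists (branch_inv e m p) => //; split => //.
  have b0 : (branch_inv e m p).1 != 0.
    rewrite -[_ == _]negbK; apply/negP => b0; move: hY.
    by rewrite -np /natext ifT ?ltxx //; move: b0; rewrite negbK.
  by rewrite (Qadj_natext1 b0) (Qadj_natext2 b0) np.
(* Where q.2 > p.2 / 2, a preimage digit m satisfies m <= 1 / q.2 + 1 <= 2 / p.2 + 1 < N. As m > 0,
   the index m - 1 ranges over ['I_N]. *)
have [N hN] : exists N : nat, 2 / p.2 + 1 < N%:R.
  by exists (Num.truncn (2 / p.2 + 1)).+1; exact: truncnS_gt.
apply: contrapT => nO.
pose sg (b : bool) : R := if b then 1 else -1.
have nO' : \forall q \near p, forall i : bool * 'I_N,
    ~ Omega alpha (branch_inv (sg i.1) i.2.+1 q).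
  apply: (@filter_forall _ _ (fun (i : bool * 'I_N) q =>
    ~ Omega alpha (branch_inv (sg i.1) i.2.+1 q)) (nbhs p)) => -[b i] /=.
  have cg : branch_inv (sg b) i.+1 q @[q --> p] --> branch_inv (sg b) i.+1 p.
    apply: (@cvg_pair _ _ _ (nbhs p) (nbhs (branch_inv (sg b) i.+1 p).1)
      (nbhs (branch_inv (sg b) i.+1 p).2) _ _ _
      (fun q => (branch_inv (sg b) i.+1 q).1) (fun q => (branch_inv (sg b) i.+1 q).2)).
      apply: cvgM; first exact: cvg_cst.
      apply: cvgV.
        rewrite gt_eqF //; have : 1 <= i.+1%:R :> R by rewrite ler1n.
        by move: alpha01; lra.
      by apply: cvgD; [exact: cvg_fst|exact: cvg_cst].
    apply: cvgM; first exact: cvg_cst.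
    apply: cvgB; last exact: cvg_cst.
    by apply: cvgV; [rewrite gt_eqF|exact: cvg_snd].
  apply: (cg (~` Omega alpha)); apply: open_nbhs_nbhs; split.
    by apply: closed_openC; exact: closed_closure.
  move=> Oi; apply: nO; exists (sg b), i.+1; split => //.
  by rewrite /sg; case: (b); [right|left].
have nY : \forall q \near p, p.2 / 2 < q.2.
  apply: (@cvg_snd _ _ (nbhs p.1) (nbhs p.2) _ (fun z => p.2 / 2 < z)).
  by apply: (cvgr_gt _ (@cvg_id _ (nbhs p.2))); lra.
have [q [Sq [/= nOq Yq]]] := Op _ (filterI nO' nY).
have q2 : 0 < q.2 by lra.
(* A starting point (x, 0) of an orbit has second coordinate 0, so q occurs later in its orbit. *)
have [r Sr qr] : exists2 r, orbits r & q = natext alpha r.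
  move: Sq => [[|n] [x [hx qE]]]; first by move: q2; rewrite qE ltxx.
  by exists (iter n (natext alpha) (x, 0)) => //; exists n, x.
have r0 : r.1 != 0 by apply/eqP => r0; move: q2; rewrite qr /natext r0 eqxx ltxx.
have [m [m0 rE mle]] := branch_inv_natext (orbits_strip Sr) r0.
have mN : (m.-1 < N)%N.
  rewrite prednK // -(ler_nat R); apply/ltW/(le_lt_trans mle)/(le_lt_trans _ hN).
  rewrite lerD2r -qr -[2 / p.2]invf_div lef_pV2 ?posrE //; lra.
apply: (nOq (0 <= r.1, Ordinal mN)) => /=.
by rewrite prednK // qr rE; exact: subset_closure.
Qed.

End NaturalExtension.

(** * Labels in the coordinates of the natural extension *)

Section Labels.
Context {R : realType} (alpha : R) (alpha01 : 0 < alpha <= 1).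
Implicit Types (s t x y z : R) (p q w : R * R) (A : SL2 R).

Local Notation strip := (strip alpha).
Local Notation regular := (regular alpha).

Definition lab p s : T1M R := pt (Zmap p, s).
Definition repr_lab p s : SL2 R := Asl2 s p.1 (Zmap p).2.

(** The extreme case is the corner (alpha - 1, 1). In particular [Zmap] has no pole on the strip. *)
Lemma strip_denom p : strip p -> alpha <= 1 + p.1 * p.2.
Proof.
move=> [/andP[x1 x2] /andP[y1 y2]].
have : 0 <= (p.1 - (alpha - 1)) * p.2 by rewrite mulr_ge0 // subr_ge0.
have : 0 <= (1 - alpha) * (1 - p.2) by rewrite mulr_ge0 //; move: alpha01; lra.
lra.
Qed.

Lemma Zmap_denom p : strip p -> 1 - p.1 * (Zmap p).2 = (1 + p.1 * p.2)^-1.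
Proof.
move=> /strip_denom h; rewrite /Zmap /=; field.
by apply/eqP => e; move: alpha01; lra.
Qed.

Lemma Zmap_sndK p : strip p -> (Zmap p).2 / (1 - p.1 * (Zmap p).2) = p.2.
Proof.
move=> sp; rewrite Zmap_denom // invrK divfK //; apply/eqP => e.
by have := strip_denom sp; move: alpha01; lra.
Qed.

(** For the image (X', Y') of (X, Y), [e3] says 1 + X' Y' = (1 + X Y) Y' / |X|, so Y' / (1 + X' Y')
    = |X| / (1 + X Y). Thus [Zmap] conjugates [natext] to [Phi] without its sign. *)
Lemma Zmap_natext p : strip p -> p.1 != 0 ->
  Zmap (natext alpha p) =
  (Tmap alpha p.1, eps p.1 * p.1 * (1 - p.1 * (Zmap p).2)).
Proof.
move=> sp p0; rewrite Zmap_denom // eps_mul /Zmap /natext (negbTE p0) /=.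
congr pair.
have d1 := denom_ge1 alpha01 p0 sp; have d2 := strip_denom sp.
have e1 := eps_mul p.1; have e2 := eps_norm p.1.
have n0 : 0 < `|p.1| by rewrite normr_gt0.
have e3 : 1 + Tmap alpha p.1 / (digit alpha p.1 + eps p.1 * p.2) =
    (1 + p.1 * p.2) / `|p.1| / (digit alpha p.1 + eps p.1 * p.2).
  rewrite /Tmap (negbTE p0) normfV.
  rewrite (_ : p.1 * p.2 = eps p.1 * `|p.1| * p.2); last by rewrite e2.
  by field; rewrite !gt_eqF //; lra.
rewrite e3; field; rewrite !gt_eqF //; by move: alpha01; lra.
Qed.

Lemma flow_lab p s : strip p -> p.1 != 0 -> s = -1 \/ s = 1 ->
  flow (- (ln `|p.1| *+ 2)) (lab p s) = lab (natext alpha p) (- eps p.1 * s).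
Proof.
move=> sp p0 hs; rewrite /lab Zmap_natext //.
by rewrite -(flow_Phi alpha (Zmap p).2 hs p0); case: (p).
Qed.

Lemma generic_lab p s : strip p -> s = -1 \/ s = 1 ->
  generic alpha (repr_lab p s) <-> ~ Qadj alpha p.1 /\ ~ Qadj alpha p.2.
Proof.
move=> sp hs; rewrite generic_Asl2 //; last first.
  rewrite Zmap_denom // invr_eq0; apply/eqP => e.
  by have := strip_denom sp; move: alpha01; lra.
by rewrite Zmap_sndK.
Qed.

Lemma Zmap_snd_gt0 p : strip p -> 0 < p.2 -> 0 < (Zmap p).2.
Proof.
move=> /strip_denom h h2; rewrite /Zmap /= divr_gt0 //.
by move: alpha01; lra.
Qed.

Lemma lab_inj p s p' s' : s = -1 \/ s = 1 -> s' = -1 \/ s' = 1 ->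
  strip p -> ~ Qadj alpha p.1 -> ~ Qadj alpha p.2 -> strip p' ->
  lab p s = lab p' s' -> p = p' /\ s = s'.
Proof.
move=> hs hs' sp K1 K2 sp' e.
have h q : strip q -> 0 <= (Zmap q).2.
  move=> sq; rewrite /Zmap /= divr_ge0 //; first by case: sq => _ /andP[].
  by have := strip_denom sq; move: alpha01; lra.
have n0 : 1 - p.1 * (Zmap p).2 != 0.
  rewrite Zmap_denom // invr_eq0; apply/eqP => e0.
  by have := strip_denom sp; move: alpha01; lra.
have g := (generic_lab sp hs).2 (conj K1 K2).
have [e1 e2 ->] := label_unique hs hs' sp.1 sp'.1 (h _ sp) (h _ sp') n0 g e.
split => //.
rewrite [p]surjective_pairing [p']surjective_pairing -(Zmap_sndK sp).
by rewrite -(Zmap_sndK sp') (_ : (Zmap p).2 = (Zmap p').2) // e1.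
Qed.

Lemma regular_strip p : regular p -> strip p.
Proof. by move=> [Op _]; exact: Omega_strip Op. Qed.

Lemma regular_neq0 p : regular p -> p.1 != 0.
Proof. by move=> [_ [K1 _]]; exact: Qadj_neq0 K1. Qed.

Lemma regular_snd_gt0 p : regular p -> 0 < p.2.
Proof.
move=> rp; have [_ /andP[h _]] := regular_strip rp.
by rewrite lt_def h andbT; case: rp => _ [_ /Qadj_neq0].
Qed.

Lemma regular_lt1 p : regular p -> `|p.1| < 1.
Proof.
move=> rp; have [/andP[h1 h2] _] := regular_strip rp.
case: rp => _ [K1 _]; have n1 : p.1 != 1.
  by apply/eqP => e; apply: K1; rewrite e; exact: Qadj1.
move: n1; rewrite ltr_norml neq_lt => /orP[?|?]; move: alpha01; lra.
Qed.

(* For alpha = 1 a single factor |p.1| may be arbitrarily close to 1. *)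
Lemma natext_contraction : exists2 r, 0 < r < 1 &
  forall p, regular p -> `|p.1| * `|(natext alpha p).1| <= r.
Proof.
have [a1|a1] := ltP alpha 1.
  have [r [r0 r1 hr]] : exists r, [/\ 0 < r, r < 1 &
      forall x, alpha - 1 <= x <= alpha -> `|x| <= r].
    have [h|h] := leP alpha (1 - alpha).
      exists (1 - alpha); split; try by move: alpha01; lra.
      by move=> x hx; rewrite ler_norml; lra.
    exists alpha; split; try by move: alpha01; lra.
    by move=> x hx; rewrite ler_norml; lra.
  exists r; first by rewrite r0.
  move=> p rp; have h1 := hr _ (regular_strip rp).1.
  have h2 := hr _ (regular_strip (regular_natext alpha01 rp)).1.
  by have := normr_ge0 p.1; have := normr_ge0 (natext alpha p).1; nra.
have e1 : alpha = 1 by move: alpha01; lra.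
(* Here X T(X) = 1 - d X is at most 1 - X, as d >= 1, and at most X, as T(X) < 1. *)
exists (2^-1); first lra.
move=> p rp; have p0 := regular_neq0 rp; have := regular_lt1 rp.
have [d1 _] := digit_ge1 alpha01 p0 (regular_strip rp).1.
have /andP[t1 t2] := Tmap_bounds alpha01 p.1.
have [/andP[h1 _] _] := regular_strip rp.
have pp : 0 < p.1 by rewrite lt_def p0; move: h1; rewrite e1; lra.
rewrite /natext (negbTE p0) /= (gtr0_norm pp) => p1.
rewrite ger0_norm; last by move: t1; rewrite e1; lra.
have e : p.1 * Tmap alpha p.1 = 1 - digit alpha p.1 * p.1.
  by rewrite /Tmap (negbTE p0) normfV (gtr0_norm pp); field.
move: t2; rewrite e1 => t2.
have : p.1 * Tmap 1 p.1 <= p.1 by nra.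
by move: e; rewrite e1 => e; move: d1; rewrite e1; nra.
Qed.

End Labels.

(** * Backward sequences of labels and the absence of early returns *)

Section Chains.
Context {R : realType} (alpha : R) (alpha01 : 0 < alpha <= 1).
Implicit Types (x y z : R) (w : R * R) (A : SL2 R).

Local Notation strip := (strip alpha).
Local Notation regular := (regular alpha).

(* A label of the class of A at each of the times - t 0, - t 1, ..., obtained by
   iterating preimages of the natural extension. In the lattice of A, the
   vector marked by the k-th label has first coordinate e^(t k / 2). *)
Definition chain A (p : nat -> R * R) (s t : nat -> R) := forall k,
  [/\ regular (p k), s k = -1 \/ s k = 1, flow (t k) (lab (p k) (s k)) = cls A,
      natext alpha (p k.+1) = p k &
      s k = - eps (p k.+1).1 * s k.+1 /\ t k.+1 = t k - ln `|(p k.+1).1| *+ 2].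

Lemma chain_exists A p0 s0 t0 : regular p0 -> s0 = -1 \/ s0 = 1 ->
  flow t0 (lab p0 s0) = cls A ->
  exists p s t, [/\ chain A p s t, p 0 = p0, s 0 = s0 & t 0 = t0].
Proof.
move=> r0 hs0 f0.
pose P (c : (R * R) * R * R) := [/\ regular c.1.1, c.1.2 = -1 \/ c.1.2 = 1 &
  flow c.2 (lab c.1.1 c.1.2) = cls A].
(* Making [Q] conditional on [P c] gives every triple a successor, as dependent choice demands; [P]
   then propagates from the initial triple. *)
pose Q (c c' : (R * R) * R * R) := P c -> [/\ P c',
  natext alpha c'.1.1 = c.1.1, c.1.2 = - eps c'.1.1.1 * c'.1.2 &
  c'.2 = c.2 - ln `|c'.1.1.1| *+ 2].
have step c : {c' | Q c c'}.
  apply: cid; have [[rc hs fc]|nP] := pselect (P c); last by exists c.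
  have [q rq qc] := regular_preimage alpha01 rc.
  pose s' := - eps q.1 * c.1.2.
  have hs' : s' = -1 \/ s' = 1.
    by rewrite /s'; case: hs => ->; have [->|->] := epsE q.1; lra.
  have es : c.1.2 = - eps q.1 * s'.
    by rewrite /s' mulrA mulrNN eps_sqr mul1r.
  exists (q, s', c.2 - ln `|q.1| *+ 2) => _; split => //=; split => //=.
  rewrite flowD (flow_lab alpha01) //; last 2 first.
  - exact (regular_strip alpha01 rq).
  - exact: regular_neq0 rq.
  by rewrite -es qc.
have [f [f0' fS]] := dependent_choice step (p0, s0, t0).
have Pf k : P (f k).
  by elim: k => [|k /fS[]//]; rewrite f0'.
exists (fun k => (f k).1.1), (fun k => (f k).1.2), (fun k => (f k).2).
rewrite f0'; split => // k; have [r h fl] := Pf k.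
by have [_ e1 e2 e3] := fS k (Pf k); split.
Qed.

Section OneChain.
Context (A : SL2 R) (p : nat -> R * R) (s t : nat -> R) (chA : chain A p s t).

Let lam k := expR (t k / 2).
Let mu k := expR (- (t k / 2)).
Let y k := (Zmap (p k)).2.

Let lam_mu k : lam k * mu k = 1.
Proof. by rewrite /lam /mu -expRD subrr expR0. Qed.

(** The vector w0 of the k-th label, transported by the flow to the lattice of A; [chain_vector2]
    transports w1. *)
Lemma chain_vector k : lat A (lam k, - (s k * y k * mu k)).
Proof.
have [_ hs fl _ _] := chA k.
move: fl; rewrite /lab /pt flow_cls => /lat_cls; apply.
have := lat_geod (t k) (lat_Asl2_1 (p k).1 (y k) hs).
by rewrite /= mul1r mulNr.
Qed.

Lemma chain_vector2 k :
  lat A (- (p k).1 * lam k, - (s k * (1 - (p k).1 * y k) * mu k)).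
Proof.
have [_ hs fl _ _] := chA k.
move: fl; rewrite /lab /pt flow_cls => /lat_cls; apply.
rewrite -[- (_ * mu k)]mulNr.
by have := lat_geod (t k) (lat_Asl2_2 (p k).1 (y k) hs).
Qed.

Lemma chain_mu k : mu k.+1 = mu k * `|(p k.+1).1|.
Proof.
have [_ _ _ _ [_ tk]] := chA k; have [r _ _ _ _] := chA k.+1.
rewrite /mu tk -[in RHS](@lnK _ `|(p k.+1).1|) ?posrE ?normr_gt0.
  by rewrite -expRD -mulr_natr; congr expR; field.
exact: regular_neq0 r.
Qed.

(** By [natext_contraction], [mu] decays geometrically along even indices. *)
Lemma chain_mu_small e : 0 < e -> exists k, mu k < e.
Proof.
move=> e0; have [r /andP[r0 r1] hr] := natext_contraction alpha01.
have h k : mu k.*2 <= r ^+ k * mu 0.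
  elim: k => [|k IH]; first by rewrite expr0 mul1r.
  rewrite doubleS !chain_mu -mulrA exprSr.
  rewrite -[r ^+ k * r * _]mulrA [r * _]mulrC [r ^+ k * _]mulrA.
  have [rp _ _ _ _] := chA k.*2.+2; have [_ _ _ e' _] := chA k.*2.+1.
  have hk : `|(p k.*2.+1).1| * `|(p k.*2.+2).1| <= r.
    by rewrite mulrC -e' hr.
  by apply: ler_pM; rewrite ?mulr_ge0 ?expR_ge0.
have : r ^+ k @[k --> \oo] --> 0.
  by apply: cvg_expr; rewrite gtr0_norm.
have em : 0 < e / mu 0 by rewrite divr_gt0 // expR_gt0.
move=> /(cvgr_lt 0) /(_ _ em) [k _ hk].
exists k.*2; apply: le_lt_trans (h k) _.
by rewrite -ltr_pdivlMr ?expR_gt0 //; apply: hk => /=.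
Qed.

(** The left side equals 1 / (1 + X Y) at the point [p k.+1]. *)
Lemma chain_area k : lam k.+1 * (y k * mu k) <= alpha^-1.
Proof.
have [r _ _ _ _] := chA k.+1; have [_ _ _ e _] := chA k.
have sp := regular_strip alpha01 r; have n0 := regular_neq0 r.
have -> : y k = `|(p k.+1).1| / (1 + (p k.+1).1 * (p k.+1).2).
  by rewrite /y -e (Zmap_natext alpha01) //= eps_mul (Zmap_denom alpha01).
have := lam_mu k.+1; rewrite chain_mu => lm.
have d := strip_denom alpha01 sp.
rewrite (_ : _ * _ = (1 + (p k.+1).1 * (p k.+1).2)^-1).
  by rewrite lef_pV2 ?posrE //; move: alpha01; lra.
rewrite -[RHS]mulr1 -lm; ring.
Qed.

Lemma chain_y_gt0 k : 0 < y k.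
Proof.
have [r _ _ _ _] := chA k.
by apply: (Zmap_snd_gt0 alpha01 (regular_strip alpha01 r)); exact: (regular_snd_gt0 alpha01 r).
Qed.

(** For a suitable k the cross product is an integer whose two terms are both below 1/2. The last
    hypothesis excludes k = 0, so that [chain_area] is available at the predecessor. *)
Lemma chain_crosses w : lat A w -> `|w.1 * w.2| < alpha / 4 ->
  1 / 2 <= `|w.1| * (y 0 * mu 0) ->
  exists k, cross w (lam k, - (s k * y k * mu k)) = 0.
Proof.
move=> Aw small big.
have n1 : 0 < `|w.1|.
  rewrite normr_gt0; apply/eqP => w0; move: big; rewrite w0 normr0 mul0r; lra.
have a0 : 0 < alpha by case/andP: alpha01.
(* By [chain_area], y k * mu k <= mu k.+1 / alpha, and [mu] becomes arbitrarily small. *)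
have ex : exists k, `|w.1| * (y k * mu k) < 1 / 2.
  have e0 : 0 < alpha / (2 * `|w.1|) by rewrite divr_gt0 // mulr_gt0.
  have [k hk] := chain_mu_small e0; exists k.
  have [r _ _ _ _] := chA k.+1; have r1 := regular_lt1 alpha01 r.
  have m1 : mu k.+1 < alpha / (2 * `|w.1|).
    by rewrite chain_mu (le_lt_trans _ hk) // ler_piMr ?expR_ge0 // ltW.
  have : y k * mu k <= mu k.+1 / alpha.
    rewrite -[_ * mu k]mul1r -(lam_mu k.+1) [lam _ * _]mulrC -mulrA.
    by rewrite ler_wpM2l ?expR_ge0 // chain_area.
  move=> h; rewrite mulrC -ltr_pdivlMr //; apply: le_lt_trans h _.
  rewrite ltr_pdivrMr //; apply: lt_le_trans m1 _.
  rewrite (_ : 1 / 2 / `|w.1| * alpha = alpha / (2 * `|w.1|)) //.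
  by field; rewrite gt_eqF.
(* For the first k with |w.1| * (y k * mu k) < 1 / 2, chain_area at k - 1 bounds
   lam k by 2 |w.1| / alpha, so the integer cross product is less than 1. *)
case: (ex_minnP ex) => -[|k] hk kmin.
  by move: hk big; lra.
exists k.+1.
have big' : 1 / 2 <= `|w.1| * (y k * mu k).
  by rewrite leNgt; apply/negP => /kmin; rewrite ltnn.
have small' : `|w.2| * lam k.+1 < 1 / 2.
  have area := chain_area k.
  have l0 : 0 < lam k.+1 := expR_gt0 _.
  have h1 : lam k.+1 <= `|w.1| * (2 / alpha).
    have yy : 0 < y k * mu k by rewrite mulr_gt0 ?chain_y_gt0 ?expR_gt0.
    rewrite -(ler_pM2r yy); apply: le_trans area _.
    have -> : `|w.1| * (2 / alpha) * (y k * mu k) =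
       alpha^-1 * (2 * (`|w.1| * (y k * mu k))) by ring.
    by rewrite ler_peMr ?invr_ge0 ?(ltW a0) //; lra.
  move: small; rewrite normrM => small.
  apply: (@le_lt_trans _ _ (`|w.2| * (`|w.1| * (2 / alpha)))).
    by rewrite ler_wpM2l.
  have -> : `|w.2| * (`|w.1| * (2 / alpha)) = `|w.1| * `|w.2| * 2 / alpha by ring.
  by rewrite ltr_pdivrMr //; lra.
have [n en] := lat_cross Aw (chain_vector k.+1).
rewrite en; suff -> : n = 0 by [].
have : `|n%:~R : R| < 1.
  rewrite -en /cross /=; apply: le_lt_trans (ler_normB _ _) _.
  have [_ hs _ _ _] := chA k.+1.
  have ns : `|s k.+1| = 1 by case: hs => ->; rewrite ?normrN normr1.
  rewrite mulrN normrN normrM [`|s _ * _ * _|]normrM [`|s _ * _|]normrM ns.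
  rewrite [`|w.2 * _|]normrM mul1r (gtr0_norm (chain_y_gt0 k.+1)).
  rewrite [`|mu _|]gtr0_norm ?expR_gt0 // [`|lam _|]gtr0_norm ?expR_gt0 //.
  by move: hk; lra.
by rewrite -intr_norm -[X in _ < X]/(1%:~R) ltr_int; lia.
Qed.

End OneChain.

Definition approximable A := forall L : R, exists w,
  [/\ lat A w, L <= `|w.1| & `|w.1 * w.2| < alpha / 4].

(** The k-th vector is completed to a basis by [chain_vector2], so a collinear lattice vector is an
    integer multiple n of it up to sign; n is nonzero, which orders the first coordinates. Used in
    both directions, this yields equal times. *)
Lemma chain_vector_primitive A p s t p' s' t' k j :
  chain A p s t -> chain A p' s' t' ->
  cross (expR (t k / 2), - (s k * (Zmap (p k)).2 * expR (- (t k / 2))))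
    (expR (t' j / 2), - (s' j * (Zmap (p' j)).2 * expR (- (t' j / 2)))) = 0 ->
  t k <= t' j.
Proof.
move=> ch ch' e.
have [n en] := lat_cross (chain_vector2 ch k) (chain_vector ch' j).
have [_ hs _ _ _] := ch k.
move: e en; rewrite /cross /=; set lk := expR (t k / 2).
set v := - (s' j * _ * _); set lj := expR (t' j / 2); set mk := expR (- (t k / 2)).
set y := _ / (1 + _) => e en.
have lm : lk * mk = 1 by rewrite /lk /mk -expRD subrr expR0.
have lk0 : 0 < lk := expR_gt0 _; have lj0 : 0 < lj := expR_gt0 _.
have en' : n%:~R * lk = s k * lj.
  transitivity (s k * lj * (lk * mk) - (p k).1 * lk * (lk * v - - (s k * y * mk) * lj)).
    by rewrite -en; ring.
  by rewrite e lm mulr0 subr0 mulr1.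
have nl : `|n%:~R| * lk = lj.
  rewrite -[in LHS](gtr0_norm lk0) -normrM en' normrM (gtr0_norm lj0).
  by case: hs => ->; rewrite ?normrN normr1 mul1r.
have n0 : n != 0 by apply/eqP => n0; move: nl; rewrite n0 normr0 mul0r; lra.
have : lk <= lj.
  rewrite -nl ler_peMl ?(ltW lk0) // -intr_norm -[X in X <= _]/(1%:~R) ler_int.
  by lia.
by rewrite ler_expR ler_pM2r ?invr_gt0.
Qed.

(** One approximating vector is collinear with a vector of each chain. These two are then collinear,
    so their times agree, and [lab_inj] identifies the labels. *)
Lemma chains_meet A p s t p' s' t' : approximable A ->
  chain A p s t -> chain A p' s' t' ->
  exists k j, [/\ t k = t' j, p k = p' j & s k = s' j].
Proof.
move=> apx ch ch'.
pose c := (Zmap (p 0)).2 * expR (- (t 0 / 2)).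
pose c' := (Zmap (p' 0)).2 * expR (- (t' 0 / 2)).
have c0 : 0 < c by rewrite mulr_gt0 ?expR_gt0 ?(chain_y_gt0 ch).
have c'0 : 0 < c' by rewrite mulr_gt0 ?expR_gt0 ?(chain_y_gt0 ch').
(* The sum of the two thresholds meets the lower bound of [chain_crosses] for both chains at
   once. *)
have [w [Aw big small]] := apx ((1 / 2) / c + (1 / 2) / c').
have h1 : 0 < 1 / 2 / c by rewrite divr_gt0.
have h2 : 0 < 1 / 2 / c' by rewrite divr_gt0.
have [|k ek] := chain_crosses ch Aw small.
  by rewrite -ler_pdivrMr // -/c; lra.
have [|j ej] := chain_crosses ch' Aw small.
  by rewrite -ler_pdivrMr // -/c'; lra.
have w0 : w.1 != 0 by rewrite -normr_gt0; lra.
set wk := (_, _) in ek; set wj := (_, _) in ej.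
have ekj : cross wk wj = 0.
  apply: (mulfI w0); rewrite mulr0.
  transitivity (wk.1 * cross w wj - wj.1 * cross w wk); first by rewrite /cross; ring.
  by rewrite ej ek !mulr0 subrr.
have ejk : cross wj wk = 0.
  by rewrite -[RHS]oppr0 -ekj /cross; ring.
have tt' : t k = t' j.
  apply/eqP; rewrite eq_le (chain_vector_primitive ch ch' ekj).
  exact: (chain_vector_primitive ch' ch ejk).
have [r hs fl _ _] := ch k; have [r' hs' fl' _ _] := ch' j.
have e : lab (p k) (s k) = lab (p' j) (s' j).
  rewrite -[LHS]flow0 -[RHS]flow0 -(addNr (t k)) !flowD fl tt'.
  by rewrite fl'.
have [_ [K1 K2]] := r.
have [ep es] := lab_inj alpha01 hs hs' (regular_strip alpha01 r) K1 K2
  (regular_strip alpha01 r') e.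
by exists k, j.
Qed.

Lemma chain_time_lt A p s t k : chain A p s t -> t k < t k.+1.
Proof.
move=> ch; have [_ _ _ _ [_ ->]] := ch k; have [r _ _ _ _] := ch k.+1.
have := regular_lt1 alpha01 r; have := regular_neq0 r.
rewrite -normr_gt0 => n0 n1; have : ln `|(p k.+1).1| < 0 by rewrite ln_lt0 ?n0.
by rewrite -mulr_natr; lra.
Qed.

Lemma chain_time_le A p s t k : chain A p s t -> t 0 <= t k.
Proof.
move=> ch; elim: k => // k IH; apply: le_trans IH _.
exact/ltW/(chain_time_lt k ch).
Qed.

(** From a common label both chains descend in step, since [natext] determines each label from the
    next one, until an index reaches 0. The first chain cannot start at or before the second, so the
    second still has a label one [natext] step past [p 0], and its start is no earlier on the flow
    line. *)
Lemma chain_no_return A p s t p' s' t' : approximable A ->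
  chain A p s t -> chain A p' s' t' ->
  t' 0 < t 0 -> t' 0 <= t 0 + ln `|(p 0).1| *+ 2.
Proof.
move=> apx ch ch' lt0.
have [k [j [+ + +]]] := chains_meet apx ch ch'.
elim: k j => [|k IH] [|j] tE pE sE.
- by move: lt0; rewrite tE ltxx.
- have [_ _ _ _ [_ tj]] := ch' j; have := chain_time_le j ch'.
  by move: tj; rewrite -tE -pE; lra.
- by have := chain_time_le k.+1 ch; rewrite tE; lra.
have [_ _ _ nk [sk tk]] := ch k; have [_ _ _ nj [sj tj]] := ch' j.
apply: (IH j).
- by move: tE; rewrite tk tj pE; lra.
- by rewrite -nk -nj pE.
- by rewrite sk sj pE sE.
Qed.

Lemma first_return_lab p s : regular p -> s = -1 \/ s = 1 ->
  approximable (repr_lab p s) ->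
  first_return (Sigmat alpha) (lab p s) (lab (natext alpha p) (- eps p.1 * s)).
Proof.
move=> r hs apx; set A := repr_lab p s.
have n0 := regular_neq0 r; have n1 := regular_lt1 alpha01 r.
have sp := regular_strip alpha01 r.
have labE : lab p s = cls A by [].
exists (- (ln `|p.1| *+ 2)).
have l0 : ln `|p.1| < 0 by rewrite ln_lt0 // normr_gt0 n0.
have inSigma q e : Omega alpha q -> e = -1 \/ e = 1 -> Sigmat alpha (lab q e).
  move=> Oq he; have sq := Omega_strip alpha01 Oq.
  have Sq : Sigma alpha (Zmap q).
    exists q => //; split => //=; apply/eqP => e0.
    by have := strip_denom alpha01 sq; move: alpha01; rewrite e0; lra.
  by case: he => ->; [left|right]; exists (Zmap q).
split.
- by rewrite -mulr_natr; lra.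
- rewrite (flow_lab alpha01) //; apply: inSigma.
    by have [] := regular_natext alpha01 r.
  by case: hs => ->; have [->|->] := epsE p.1; lra.
(* A label met at time t is regular because genericity persists along the flow line. It starts a
   second chain at - t, to which [chain_no_return] applies. *)
- move=> t /andP[t0 tt] Ct.
  have [q [s' [Oq hs' eq]]] : exists q s', [/\ Omega alpha q, s' = -1 \/ s' = 1 &
      flow t (lab p s) = lab q s'].
    case: Ct => -[_ [q [Oq _] <-] e].
      by exists q, (-1); split => //; left.
    by exists q, 1; split => //; right.
  have sq := Omega_strip alpha01 Oq.
  have gA : generic alpha A by apply/(generic_lab alpha01) => //; case: r => _.
  have [K1 K2] : ~ Qadj alpha q.1 /\ ~ Qadj alpha q.2.
    apply/(generic_lab alpha01 sq hs').
    apply: generic_cls (generic_geod t gA).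
    by rewrite -[RHS]/(lab q s') -eq labE flow_cls.
  have rq : regular q by [].
  have [p1 [s1 [t1 [ch1 p10 _ t10]]]] := chain_exists r hs (etrans (flow0 _) labE).
  have [|p2 [s2 [t2 [ch2 _ _ t20]]]] := @chain_exists A q s' (- t) rq hs'.
    by rewrite -eq -flowD addNr flow0.
  have := chain_no_return apx ch1 ch2; rewrite t10 t20 p10.
  by move=> /(_ _); rewrite oppr_lt0 => /(_ t0); lra.
- by rewrite (flow_lab alpha01).
Qed.

End Chains.

(** * Null sets by Lebesgue's density theorem *)

Section PorousSets.
Context {R : realType}.
Local Notation mR := (measurableTypeR R).
Local Notation mu := (@lebesgue_measure R).

(** Almost every point of E has density 1, whereas a hole of relative size k at arbitrarily small
    radii keeps the density ratio at most 1 - k there. *)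
Lemma porous_null (E : set mR) : measurable E ->
  (forall y : R, E y -> exists2 k : R, 0 < k & forall d, 0 < d -> exists r z : R,
    [/\ 0 < r < d, ball z (k * r) `<=` ball y r & E `&` ball z (k * r) = set0]) ->
  mu E = 0.
Proof.
move=> mE por; apply/negligibleP => //.
apply: negligibleS (lebesgue_density mE) => y Ey /= cy.
have [k k0 hk] := por y Ey.
have {cy} : \forall r \near 0^'+, ((1 - k)%:E <
    mu (E `&` ball y r) / mu (ball y r))%E.
  apply: (cy [set u | ((1 - k)%:E < u)%E]); rewrite indicE mem_set //.
  by apply: open_ereal_gt'; rewrite lte_fin /= mulr1n; lra.
move=> /nbhs_ballP[d /= d0 hd].
have [r [z [/andP[r0 rd] sub dis]]] := hk d d0.
have := hd r; rewrite /ball /= sub0r normrN gtr0_norm // => /(_ rd r0).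
apply/negP; rewrite -leNgt.
have mball u e : measurable (ball u e : set mR) by exact: measurable_ball.
have kr0 : 0 < k * r by rewrite mulr_gt0.
have le1 : (mu (E `&` ball y r) + mu (ball z (k * r)) <= mu (ball y r))%E.
  rewrite -measureU //; last 2 first.
  - exact: measurableI.
  - by rewrite setIAC dis set0I.
  apply: le_measure; rewrite ?inE //; first by apply: measurableU => //; exact: measurableI.
  by move=> u [[]|/sub].
rewrite lebesgue_measure_ball ?(ltW r0) // inver gt_eqF ?pmulrn_rgt0 //.
rewrite !lebesgue_measure_ball ?(ltW kr0) ?(ltW r0) // in le1.
have fin : mu (E `&` ball y r) \is a fin_num.
  rewrite ge0_fin_numE ?measure_ge0 //.
  apply: le_lt_trans (ltry (r *+ 2)).
  by apply: le_trans le1; rewrite leeDl // lee_fin mulrn_wge0 // ltW.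
have [F eF] : exists F, mu (E `&` ball y r) = F%:E.
  by exists (fine (mu (E `&` ball y r))); rewrite fineK.
rewrite eF in le1 *; clear -le1 r0.
move: le1; rewrite -EFinD -EFinM !lee_fin ler_pdivrMr ?pmulrn_rgt0 //.
by rewrite mulrBl mul1r lerBrDr mulrnAr.
Qed.

Lemma lebesgue2_null (N : set (mR * mR)) : measurable N ->
  (forall x, mu (xsection N x) = 0) -> lebesgue2 N = 0.
Proof. by move=> mN h; apply: integral0_eq => x _; exact: h. Qed.

Lemma countable_measurableR (K : set R) : countable K -> measurable (K : set mR).
Proof. by apply: countable_measurable => t; exact: measurable_set1. Qed.

End PorousSets.

(** * Labels whose lattices lack approximating vectors *)

Section BadLabels.
Context {R : realType} (alpha : R) (alpha01 : 0 < alpha <= 1).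
Local Notation mR := (measurableTypeR R).
Local Notation mu := (@lebesgue_measure R).
Local Notation regular := (regular alpha).

(* In the lattice of (x, y, s), the vector a w0 + b w1 is
   (l, - s (l y + b)) with l = a - b x. *)
Definition good_approx (n : nat) : set (R * R) := [set q | exists ab : int * int,
  let l := ab.1%:~R - ab.2%:~R * q.1 in
  n%:R <= `|l| /\ `|l * (l * q.2 + ab.2%:~R)| < alpha / 4].

(** Exclusion of Q(alpha) ensures that every point here comes from a regular point, hence has a
    chain. *)
Definition bad_past (n : nat) : set (R * R) := [set q | [/\ Sigma alpha q,
  ~ Qadj alpha q.1, ~ Qadj alpha (q.2 / (1 - q.1 * q.2)) & ~ good_approx n q]].

Definition bad_label : set (R * R) := [set q | Qadj alpha q.1 \/
  Qadj alpha (q.2 / (1 - q.1 * q.2)) \/ exists n, bad_past n q].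

Lemma approximableP x y s : s = -1 \/ s = 1 ->
  (forall n, good_approx n (x, y)) -> approximable alpha (Asl2 s x y).
Proof.
move=> hs h L; have [n hn] : exists n : nat, L < n%:R.
  by exists (Num.truncn L).+1; exact: truncnS_gt.
have [[a b] /= [h1 h2]] := h n.
set l := _ - _ in h1 h2.
exists (l, - (s * (l * y + b%:~R))); split => /=.
- have [c [d [e1 e2]]] := lat_Asl2_1 x y hs.
  have [c' [d' [e1' e2']]] := lat_Asl2_2 x y hs.
  exists (a * c + b * c'), (a * d + b * d') => /=.
  rewrite !rmorphD !rmorphM /=; split.
    rewrite (_ : l = a%:~R * (1, - (s * y)).1 + b%:~R * (- x, - (s * (1 - x * y))).1).
      by rewrite e1 e1'; ring.
    by rewrite /l /=; ring.
  rewrite (_ : - (s * (l * y + b%:~R)) = a%:~R * (1 : R, - (s * y)).2 +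
      b%:~R * (- x, - (s * (1 - x * y))).2).
    by rewrite e2 e2'; ring.
  by rewrite /l /=; ring.
- exact/ltW/(lt_le_trans hn).
- rewrite mulrN normrN mulrCA normrM.
  by rewrite (_ : `|s| = 1) ?mul1r //; case: hs => ->; rewrite ?normrN normr1.
Qed.

Lemma regular_of_Sigma q : Sigma alpha q -> ~ Qadj alpha q.1 ->
  ~ Qadj alpha (q.2 / (1 - q.1 * q.2)) -> exists2 p, regular p & Zmap p = q.
Proof.
move=> [p [Op _] <-] K1 K2; exists p => //; split => //; split => //.
by rewrite -(Zmap_sndK alpha01) //; exact: Omega_strip Op.
Qed.

Lemma Zmap_snd_le p : strip alpha p -> 0 <= (Zmap p).2 <= alpha^-1.
Proof.
move=> sp; have d := strip_denom alpha01 sp; have a0 : 0 < alpha by case/andP: alpha01.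
have [_ /andP[y0 y1]] := sp; rewrite /Zmap /= divr_ge0 //=; last by lra.
rewrite -[leRHS]mul1r; apply: ler_pM => //; first by rewrite invr_ge0; lra.
by rewrite lef_pV2 ?posrE //; lra.
Qed.

(* The vectors of the chain are approximations l y + b = O(1 / l) of y; each
   of them excludes from bad_past an interval around - b / l whose length is
   comparable with its distance to y. *)
Lemma bad_past_null n x : measurable (bad_past n : set (mR * mR)) ->
  mu (xsection (bad_past n) x) = 0.
Proof.
move=> mB; apply: porous_null; first exact: measurable_xsection.
move=> y; rewrite /xsection /= inE => -[Sxy K1 K2 nG].
have [p rp pE] := regular_of_Sigma Sxy K1 K2.
have p1 : p.1 = x by have := congr1 fst pE.
have hs : (-1 : R) = -1 \/ (-1 : R) = 1 by left.
have [pk [sk [tk [ch pk0 sk0 tk0]]]] :=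
  @chain_exists _ _ alpha01 (repr_lab p (-1)) p (-1) 0 rp hs (flow0 _).
have a0 : 0 < alpha by case/andP: alpha01.
(* With m = 1 / l, the hole has centre - b m, at distance at most m^2 / alpha from y, and radius
   (alpha / 4) m^2; it fits in the ball of radius C m^2 around y. *)
pose C := alpha^-1 + alpha / 4.
have ai : 0 < alpha^-1 by rewrite invr_gt0.
have C0 : 0 < C by rewrite /C; lra.
exists (alpha / 4 / C); first by rewrite divr_gt0 //; lra.
(* If m < e, then 1 / m exceeds n, and m < 1 with C m < d gives C m^2 < d. *)
move=> d d0; pose e := (1 + n%:R + C / d)^-1.
have Cd : 0 < C / d by rewrite divr_gt0.
have n0 : 0 <= n%:R :> R by [].
have e0 : 0 < e by rewrite invr_gt0; lra.
have [k hk] := chain_mu_small alpha01 ch e0.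
set m := expR _ in hk.
have m0 : 0 < m := expR_gt0 _.
have lm : expR (tk k / 2) = m^-1 by rewrite /m expRN invrK.
have minv : 1 + n%:R + C / d < m^-1.
  by rewrite -[X in X < _]invrK ltf_pV2 ?posrE.
have [a [b]] := chain_vector ch k; rewrite -/m lm.
have yE : (Zmap p).2 = y := congr1 snd pE.
move yk_def : (Zmap (pk k)).2 => yk.
rewrite /repr_lab yE p1 /= AmxN1 !mxE /= mulr1 mulrN => -[e1 e2].
have e2' : - (sk k * yk * m) = m^-1 * y + b%:~R.
  by rewrite e2 /= e1; ring.
have [rk hsk _ _ _] := ch k.
have := Zmap_snd_le (regular_strip alpha01 rk); rewrite yk_def => /andP[yk0 yk1].
have absE : `|m^-1 * y + b%:~R| = yk * m.
  rewrite -e2' normrN !normrM (ger0_norm yk0) (gtr0_norm m0).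
  by case: hsk => ->; rewrite ?normrN normr1 mul1r.
have mn : m * m^-1 = 1 by rewrite divff // gt_eqF.
have yzE : `|y + b%:~R * m| = yk * m ^+ 2.
  have -> : y + b%:~R * m = m * (m^-1 * y + b%:~R).
    by rewrite mulrDr mulrA mn mul1r mulrC [m * _]mulrC.
  by rewrite normrM absE gtr0_norm // expr2; ring.
have yzle : `|y + b%:~R * m| <= alpha^-1 * m ^+ 2.
  by rewrite yzE ler_wpM2r // sqr_ge0.
have m20 : 0 < m ^+ 2 by rewrite exprn_gt0.
have rhoE : alpha / 4 / C * (C * m ^+ 2) = alpha / 4 * m ^+ 2.
  by field; rewrite gt_eqF.
exists (C * m ^+ 2), (- (b%:~R * m)); rewrite rhoE; split.
- rewrite mulr_gt0 //=.
  have m1 : m < 1 by rewrite -[m]invrK invf_lt1 ?invr_gt0 //; lra.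
  have : C / d * m < 1.
    by rewrite -ltr_pdivlMr // div1r; lra.
  rewrite mulrAC ltr_pdivrMr // mul1r => Cm; apply: le_lt_trans Cm.
  by rewrite ler_pM2l // expr2 ler_piMr // ltW.
- move=> u; rewrite /ball /= => hu.
  apply: (@le_lt_trans _ _ (`|y + b%:~R * m| + `|- (b%:~R * m) - u|)).
    by rewrite (_ : y - u = (y + b%:~R * m) + (- (b%:~R * m) - u)) ?ler_normD //; ring.
  by move: hu yzle; rewrite /C mulrDl; lra.
- apply/seteqP; split => // u [/=]; rewrite /xsection /= inE => -[_ _ _ nGu].
  rewrite /ball /= => hu; apply: nGu; exists (a, b) => /=; rewrite -e1; split.
    by rewrite gtr0_norm ?invr_gt0 //; lra.
  have -> : m^-1 * (m^-1 * u + b%:~R) = - (m ^- 2 * (- (b%:~R * m) - u)).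
    rewrite -exprVn expr2 -[b%:~R in LHS]mulr1 -mn; ring.
  by rewrite normrN normrM gtr0_norm ?invr_gt0 // mulrC ltr_pdivrMr.
Qed.

End BadLabels.

(** * Measurability of sets of classes given by labels *)

Section MeasurableLabels.
Context {R : realType}.
Local Notation mR := (measurableTypeR R).

(** The representatives form a countable union over integral M of determinant 1: [C1 M] and [C2 M]
    require M A to be a matrix [Amx], with s = -1 and s = 1. Fixing one entry and reading x and y
    off two others suffices, as the determinant forces the fourth. *)
Lemma measurable_labels (B : set (mR * mR)) : measurable B ->
  measurable ([set v : T1M R | exists s p,
    [/\ B p, s = -1 \/ s = 1 & v = pt (p, s)]]).
Proof.
move=> mB.
pose f (M : 'M[int]_2) i (v : mR * mR) : mR := (M i 0)%:~R * v.1 + (M i 1)%:~R * v.2.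
pose c0 (v : mR * mR * mR * mR) : mR * mR := (v.1.1.1, v.1.2).
pose c1 (v : mR * mR * mR * mR) : mR * mR := (v.1.1.2, v.2).
pose C1 (M : 'M[int]_2) : set (mR * mR * mR * mR) :=
  (fun v => f M 0 (c0 v)) @^-1` [set 1] `&`
  (fun v => (- f M 1 (c0 v), f M 0 (c1 v)) : mR * mR) @^-1` B.
pose C2 (M : 'M[int]_2) : set (mR * mR * mR * mR) :=
  (fun v => f M 1 (c0 v)) @^-1` [set -1] `&`
  (fun v => (f M 0 (c0 v), f M 1 (c1 v)) : mR * mR) @^-1` B.
pose C (M : 'M[int]_2) := if \det M == 1 then C1 M `|` C2 M else set0.
have mc0 : measurable_fun setT c0.
  apply: measurable_fun_pair => //.
    exact: measurableT_comp measurable_fst (measurableT_comp measurable_fst measurable_fst).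
  exact: measurableT_comp measurable_snd measurable_fst.
have mc1 : measurable_fun setT c1.
  apply: measurable_fun_pair => //.
  exact: measurableT_comp measurable_snd (measurableT_comp measurable_fst measurable_fst).
have mf M i : measurable_fun setT (f M i).
  by apply: measurable_funD; apply: measurable_funM.
have mf0 M i : measurable_fun setT (fun v => f M i (c0 v)).
  exact: measurableT_comp (mf M i) mc0.
have mf1 M i : measurable_fun setT (fun v => f M i (c1 v)).
  exact: measurableT_comp (mf M i) mc1.
have mpre d' (T' : measurableType d') (g : mR * mR * mR * mR -> T') (D : set T') :
    measurable_fun setT g -> measurable D -> measurable (g @^-1` D).
  by move=> mg mD; rewrite -[X in measurable X]setTI; exact: mg.
have mC : measurable (\bigcup_M C M).
  apply: countable_bigcupT_measurable => // M; rewrite /C; case: ifP => // _.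
  apply: measurableU; apply: measurableI; apply: mpre => //;
    apply: measurable_fun_pair => //.
  exact: measurableT_comp.
exists (\bigcup_M C M) => //.
apply/seteqP; split => A [_ h]; split => //; move: h => /=.
  move=> [M _]; rewrite /C; case: eqP => // dM.
  have dA : \det (map_mx intr M *m val A) = 1.
    by rewrite det_mulmx det_map_mx dM det_sl2 mulr1.
  have eE := int_matrix2 (erefl (map_mx intr M *m val A)).
  rewrite [X in \det X]mx2E det_mx2 in dA.
  move=> [[/= h1 h2]|[/= h1 h2]].
    eexists (-1), _; split; [exact: h2|by left|apply/clsP; exists M; split => //=].
    rewrite AmxN1 [RHS]mx2E; move: dA; rewrite !eE /f /= in h1 *; rewrite !h1.
    by rewrite mul1r opprK => dA; congr mx2; lra.
  eexists 1, _; split; [exact: h2|by right|apply/clsP; exists M; split => //=].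
  rewrite Amx1 [RHS]mx2E; move: dA; rewrite !eE /f /= in h1 *; rewrite !h1.
  by move=> dA; congr mx2; lra.
move=> [s [p [Bp hs /clsP[M [dM /int_matrix2 AE]]]]]; exists M => //.
rewrite /C dM eqxx /C1 /C2 /f /=.
case: hs AE => -> /= AE; [left|right]; rewrite -!AE ?AmxN1 ?Amx1 !mxE /=.
  by rewrite opprK; split => //; case: (p) Bp.
by split => //; case: (p) Bp.
Qed.

End MeasurableLabels.

(** * The bad labels form a measurable null set *)

Section BadLabelsNull.
Context {R : realType} (alpha : R) (alpha01 : 0 < alpha <= 1).
Local Notation mR := (measurableTypeR R).
Local Notation mu := (@lebesgue_measure R).

Local Notation KX := [set q : mR * mR | Qadj alpha q.1].
Local Notation KY := [set q : mR * mR | Qadj alpha (q.2 / (1 - q.1 * q.2))].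

Lemma measurable_Qadj : measurable (Qadj alpha : set mR).
Proof. by apply: countable_measurableR; exact: countable_Qadj. Qed.

Lemma measurable_KX : measurable KX.
Proof.
rewrite -[X in measurable X]setTI; apply: measurable_fst => //.
exact: measurable_Qadj.
Qed.

Lemma measurable_KY : measurable KY.
Proof.
have m : measurable_fun setT (fun q : mR * mR => q.2 / (1 - q.1 * q.2) : mR).
  apply: measurable_funM => //; apply: measurableT_comp measurable_invr _.
  by apply: measurable_funB => //; apply: measurable_funM.
rewrite -[X in measurable X]setTI; apply: m => //.
exact: measurable_Qadj.
Qed.

Lemma measurable_good_approx n : measurable (good_approx alpha n : set (mR * mR)).
Proof.
pose l (ab : int * int) (q : mR * mR) : mR := ab.1%:~R - ab.2%:~R * q.1.
pose u (ab : int * int) (q : mR * mR) : mR := l ab q * (l ab q * q.2 + ab.2%:~R).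
have ml ab : measurable_fun setT (l ab).
  by apply: measurable_funB => //; apply: measurable_funM.
have mu' ab : measurable_fun setT (u ab).
  apply: measurable_funM; first exact: ml.
  by apply: measurable_funD => //; apply: measurable_funM => //; exact: ml.
rewrite (_ : good_approx alpha n = \bigcup_ab
  ((fun q => `|l ab q| : mR) @^-1` [set` `[n%:R, +oo[] `&`
   (fun q => `|u ab q| : mR) @^-1` [set` `]-oo, alpha / 4[])).
  apply: countable_bigcupT_measurable => // ab.
  apply: measurableI; rewrite -[X in measurable X]setTI.
    have h : measurable_fun setT (fun q => `|l ab q| : mR) by exact: measurableT_comp.
    exact: h.
  have h : measurable_fun setT (fun q => `|u ab q| : mR) by exact: measurableT_comp.
  exact: h.
apply/seteqP; split => q.
  by move=> [ab [h1 h2]]; exists ab => //; split; rewrite /= in_itv /= ?andbT.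
by move=> [ab _ []]; rewrite /= !in_itv /= ?andbT => h1 h2; exists ab.
Qed.

Lemma measurable_bad_past n : measurable (bad_past alpha n : set (mR * mR)).
Proof.
rewrite (_ : bad_past alpha n =
  Sigma alpha `&` (~` KX `&` (~` KY `&` ~` good_approx alpha n))); last first.
  by apply/seteqP; split => [q []|q [? [? []]]].
apply: measurableI; first exact: measurable_Sigma.
apply: measurableI; first by apply: measurableC; exact: measurable_KX.
apply: measurableI; first by apply: measurableC; exact: measurable_KY.
by apply: measurableC; exact: measurable_good_approx.
Qed.

Lemma KX_null : lebesgue2 KX = 0.
Proof.
rewrite (_ : KX = Qadj alpha `*` setT); last first.
  by apply/seteqP; split => [q|q []].
rewrite [LHS](product_measure1E mu mu) //; last exact: measurable_Qadj.
by rewrite [X in (X * _)%E](countable_lebesgue_measure0 (countable_Qadj alpha)) mul0e.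
Qed.

Lemma KY_null : lebesgue2 KY = 0.
Proof.
apply: lebesgue2_null; first exact: measurable_KY.
move=> x; apply: countable_lebesgue_measure0.
(* The extra point x^-1 is where 1 - x y = 0: the quotient then takes the default value 0, which
   lies in Q(alpha). *)
apply: (@sub_countable _ _ _ ([set Y / (1 + x * Y) | Y in Qadj alpha] `|` [set x^-1])).
  apply: subset_card_le => y; rewrite /xsection /= inE /= => Ky.
  have [e|n0] := eqVneq (1 - x * y) 0.
    by right; apply: (@mulfI _ x); [apply/eqP => x0; move: e; rewrite x0; lra|
      rewrite mulfV; [lra|apply/eqP => x0; move: e; rewrite x0; lra]].
  left; exists (y / (1 - x * y)) => //; field.
  by rewrite n0 /=; apply/eqP; lra.
rewrite -bigcup2E; apply: bigcup_countable => // -[|[|i]] _ /=.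
- by apply: sub_countable (card_image_le _ _) _; exact: countable_Qadj.
- exact: countable1.
- exact: countable0.
Qed.

Lemma bad_labelE : bad_label alpha = KX `|` (KY `|` \bigcup_n bad_past alpha n).
Proof.
apply/seteqP; split => q.
  by case=> [|[|[n]]]; [left|right; left|right; right; exists n].
by case=> [|[|[n]]]; [left|right; left|right; right; exists n].
Qed.

Lemma measurable_bad_label : measurable (bad_label alpha : set (mR * mR)).
Proof.
rewrite bad_labelE; apply: measurableU; first exact: measurable_KX.
apply: measurableU; first exact: measurable_KY.
by apply: bigcupT_measurable => n; exact: measurable_bad_past.
Qed.

Lemma bad_label_null : lebesgue2 (bad_label alpha) = 0.
Proof.
apply/negligibleP; first exact: measurable_bad_label.
rewrite bad_labelE; apply: negligibleU.
  by apply/negligibleP; [exact: measurable_KX|exact: KX_null].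
apply: negligibleU; first by apply/negligibleP; [exact: measurable_KY|exact: KY_null].
apply: negligible_bigcup => n; apply/negligibleP; first exact: measurable_bad_past.
apply: lebesgue2_null; first exact: measurable_bad_past.
by move=> x; apply: bad_past_null => //; exact: measurable_bad_past.
Qed.

Lemma Sigma_label_unique q q' s s' : s = -1 \/ s = 1 -> s' = -1 \/ s' = 1 ->
  Sigma alpha q -> ~ bad_label alpha q -> Sigma alpha q' ->
  pt (q, s) = pt (q', s') -> q = q'.
Proof.
move=> hs hs' Sq nb [p' [Op' _] <-].
have [p rp <-] := regular_of_Sigma alpha01 Sq (fun h => nb (or_introl h))
  (fun h => nb (or_intror (or_introl h))).
have [_ [K1 K2]] := rp => e.
have [-> //] := lab_inj alpha01 hs hs' (regular_strip alpha01 rp) K1 K2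
  (Omega_strip alpha01 Op') e.
Qed.

End BadLabelsNull.

(** * From null sets of labels to the almost everywhere statement on classes *)

Theorem theorem4p1 (R : realType) (alpha : R) (alpha01 : 0 < alpha <= 1) :
  {ae ell alpha, forall v : T1M R,
    forall (x y s : R), Sigma alpha (x, y) -> s = -1 \/ s = 1 ->
      v = pt (x, y, s) ->
    let: (x', y', s') := Phi alpha (x, y, s) in
    [/\ Sigma alpha (x', y'), s' = -1 \/ s' = 1
      & first_return (Sigmat alpha) v (pt (x', y', s'))]}.
Proof.
pose B := bad_label alpha `&` Sigma alpha.
have mB : measurable (B : set (measurableTypeR R * measurableTypeR R)).
  by apply: measurableI; [exact: measurable_bad_label|exact: measurable_Sigma].
(* The exceptional classes are those with some bad label on either sheet. *)
exists [set v : T1M R | exists s p, [/\ B p, s = -1 \/ s = 1 & v = pt (p, s)]].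
split; first exact: measurable_labels.
  suff sheet0 s : s = -1 \/ s = 1 -> ell_sheet alpha s
      [set v : T1M R | exists s p, [/\ B p, s = -1 \/ s = 1 & v = pt (p, s)]] = 0.
    rewrite [LHS](measure_addE (ell_sheet alpha (-1)) (ell_sheet alpha 1)).
    rewrite [X in (X + _)%E](sheet0 _ (or_introl erefl)) add0e.
    exact: (sheet0 _ (or_intror erefl)).
  move=> hs; apply/eqP; rewrite eq_le measure_ge0 andbT -(bad_label_null alpha01).
  rewrite /ell_sheet /pushforward /mrestr; apply: le_measure.
  - rewrite inE; apply: measurableI; last exact: measurable_Sigma.
    rewrite -[X in measurable X]setTI; apply: measurable_pt => //.
    exact: measurable_labels.
  - by rewrite inE; exact: measurable_bad_label.
  move=> q [/= [s' [q' [[Bq' Sq'] hs' e]]] Sq].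
  (* A good label is unique, so q would coincide with the bad label q' of the same class. *)
  apply: contrapT => nb.
  by apply: (nb); rewrite (Sigma_label_unique alpha01 hs hs' Sq nb Sq' e).
move=> v /=; apply: contra_notP => nv x y s Sxy hs ve.
have nb : ~ bad_label alpha (x, y).
  by move=> bq; apply: nv; exists s, (x, y).
have [p rp pE] := regular_of_Sigma alpha01 Sxy (fun h => nb (or_introl h))
  (fun h => nb (or_intror (or_introl h))).
have p0 := regular_neq0 rp; have sp := regular_strip alpha01 rp.
have p1 : p.1 = x := congr1 fst pE.
have PhiE : Phi alpha (x, y, s) = (Zmap (natext alpha p), - eps p.1 * s).
  by rewrite (Zmap_natext alpha01) // pE p1.
suff : let: (x', y', s') := Phi alpha (x, y, s) in
    [/\ Sigma alpha (x', y'), s' = -1 \/ s' = 1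
      & first_return (Sigmat alpha) v (pt (x', y', s'))] by [].
rewrite PhiE; case ZE : (Zmap (natext alpha p)) => [x' y'].
have rn := regular_natext alpha01 rp.
split.
- have sn := regular_strip alpha01 rn; have [On _] := rn.
  exists (natext alpha p) => //; split => //; apply/eqP => e0.
  by have := strip_denom alpha01 sn; move: alpha01; rewrite e0; lra.
- by case: hs => ->; have [->|->] := epsE p.1; lra.
rewrite ve -pE -ZE; apply: first_return_lab => //.
rewrite /repr_lab pE p1; apply: approximableP => // n.
apply: contrapT => nG; apply: (nb); right; right; exists n.
by split => // h; apply: nb; [left|right; left].
Qed.
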